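(* Let $c>0$, $\beta\in[0,1)$ and $n\in\mathbb{N}$ with $n>3c$. Then for every $f\in C_B[0,\infty)$ and every $x\ge 0$, $$|\mathcal{D}_{n,c}^{\beta}(f,x)-f(x)|\le \omega\big(f,\mu_{1,n,c}^{\beta}(x)\big)+M\,\omega_2\Big(f,\sqrt{\big(\mu_{1,n,c}^{\beta}(x)\big)^2+\mu_{2,n,c}^{\beta}(x)}\Big),$$ where $M$ is a positive absolute constant.
   Context: For $\beta\in[0,1)$, $x\ge 0$, $n\in\mathbb{N}$ and integers $v\ge0$ let $\omega_\beta(v,nx)=nx(nx+v\beta)^{v-1}\frac{e^{-(nx+v\beta)}}{v!}$. For $c>0$, integers $v\ge1$ and $t\ge0$ let $p_{n,v-1,c}(t)=c\,\frac{\Gamma(n/c+v-1)}{\Gamma(v)\Gamma(n/c)}\cdot\frac{(ct)^{v-1}}{(1+ct)^{n/c+v-1}}$. The modified Jain-Baskakov operators are $$\mathcal{D}_{n,c}^{\beta}(f,x)=\frac{n-c}{c}\sum_{v=1}^{\infty}\omega_\beta(v,nx)\int_0^\infty p_{n,v-1,c}(t)f(t)\,dt+e^{-nx}f(0).$$ $\mu_{1,n,c}^{\beta}(x)=\mathcal{D}_{n,c}^{\beta}(t-x,x)=\frac{x(n\beta+2c(1-\beta))}{(n-2c)(1-\beta)}$ and $\mu_{2,n,c}^{\beta}(x)=\mathcal{D}_{n,c}^{\beta}((t-x)^2,x)$ (operator applied to $t\mapsto (t-x)^k$, evaluated at $x$). $C_B[0,\infty)$ is the space of bounded continuous functions on $[0,\infty)$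 with the sup norm. $\omega(f,\delta)=\sup\{|f(t)-f(x)|: x,t\ge0,\ |t-x|\le\delta\}$ is the modulus of continuity and $\omega_2(f,\delta)=\sup_{0<h\le\delta}\sup_{x\ge0}|f(x+2h)-2f(x+h)+f(x)|$ is the second order modulus of smoothness. *)

(* Defs.v *)
From Stdlib Require Import Reals Arith.
From Coquelicot Require Import Coquelicot.
Open Scope R_scope.

Definition Gamma (s : R) : R :=
  RInt_gen (fun t => Rpower t (s - 1) * exp (- t)) (at_point 0) (Rbar_locally p_infty).

Definition omega_beta (beta : R) (v : nat) (nx : R) : R :=
  nx * (nx + INR v * beta) ^ (v - 1) * exp (- (nx + INR v * beta)) / INR (Factorial.fact v).

(* p_{n,v-1,c}(t), for v >= 1 *)
Definition p_kernel (n : nat) (v : nat) (c t : R) : R :=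
  c * (Gamma (INR n / c + INR v - 1) / (Gamma (INR v) * Gamma (INR n / c)))
    * ((c * t) ^ (v - 1) / Rpower (1 + c * t) (INR n / c + INR v - 1)).

Definition D_op (n : nat) (c beta : R) (f : R -> R) (x : R) : R :=
  (INR n - c) / c *
    Series (fun k => let v := S k in
       omega_beta beta v (INR n * x) *
       RInt_gen (fun t => p_kernel n v c t * f t) (at_point 0) (Rbar_locally p_infty))
  + exp (- (INR n * x)) * f 0.

Definition mu1 (n : nat) (c beta x : R) : R := D_op n c beta (fun t => t - x) x.
Definition mu2 (n : nat) (c beta x : R) : R := D_op n c beta (fun t => (t - x) ^ 2) x.

Definition CB0inf (f : R -> R) : Prop :=
  (forall x, 0 <= x -> forall eps, 0 < eps -> exists delta, 0 < delta /\
     forall y, 0 <= y -> Rabs (y - x) < delta -> Rabs (f y - f x) < eps) /\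
  (exists B, forall x, 0 <= x -> Rabs (f x) <= B).

Definition modulus1 (f : R -> R) (delta : R) : R :=
  real (Lub_Rbar (fun r => exists x t, 0 <= x /\ 0 <= t /\ Rabs (t - x) <= delta /\
                                   r = Rabs (f t - f x))).

Definition modulus2 (f : R -> R) (delta : R) : R :=
  real (Lub_Rbar (fun r => exists h x, 0 < h /\ h <= delta /\ 0 <= x /\
                                   r = Rabs (f (x + 2 * h) - 2 * f (x + h) + f x))).

(* Main.v *)
Require Import Defs.
From Stdlib Require Import Reals Lra Lia.
From Coquelicot Require Import Coquelicot.
Open Scope R_scope.

(* [D_op] is positive and reproduces constants, it maps [t] to [e = x + mu1], and
   its variance about [e] is [mu2 - mu1^2].  With [d^2 = mu1^2 + mu2], a bounded
   [f] stays within [18 * modulus2 f d * (1 + ((t - e) / d)^2)] of the line of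
   slope [(f (e + 2d) - f e) / (2d)] through [(e, f e)]: near [e] by reflecting
   points at the ends of [[e, e + 2d]], and then by steps of length [d].
   Applying [D_op] gives [|D_op f x - f e| <= 36 * modulus2 f d], while
   [|f e - f x| <= modulus1 f mu1].

   The Jain weights satisfy [w_v'(y) = w_(v-1)(y + beta) - w_v(y)], so the tails
   [R_N = 1 - sum_(v <= N) w_v] satisfy [R_N' = R_(N-1)(. + beta) - R_N]; by
   induction on [N] they lie between [0] and a geometrically decaying
   supersolution.  This yields both [sum_v w_v = 1] and the convergence of all
   the moment series. *)

(** * Approximation by lines *)

(** The comparison point is [e], not [x], because [D_op] sends a line to its value at [e]; the move
    from [x] to [e] is what the first order modulus pays for. The scale [d] satisfies
    [mu2 - mu1^2 <= d^2], so [D_op] maps [1 + ((t - e) / d)^2] to at most 2, whence [36 = 2 * 18].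
    The 18 comes from [(3 + s)^2 <= 18 * (1 + s^2)]: a point at distance [s * d] is reached in about
    [s] steps, and each step enlarges the increment of the error by at most one [modulus2]. The
    Baskakov kernels decay like [t^(- n / c)], so [n > 3 c] is what makes second moments finite.
    Dividing by [d] asks for [d > 0]; for [x > 0] this follows from [mu1 > 0], obtained by bounding
    the first Jain moment below. At [x = 0] the scale collapses and the claim is checked
    directly. *)

Definition second_diff_le (g : R -> R) (d W : R) : Prop :=
  forall y h, 0 <= y -> 0 < h <= d ->
    Rabs (g (y + 2 * h) - 2 * g (y + h) + g y) <= W.

(** Reflection improves any bound [m] to [(W + m) / 2]. The supremum of [|g|], which exists thanks
    to the crude bound [B], therefore satisfies [m <= (W + m) / 2], that is [m <= W]. *)
Lemma abs_le_of_second_diff (g : R -> R) (e d W B : R) :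
  0 <= e -> 0 < d -> second_diff_le g d W ->
  (forall y, e <= y <= e + 2 * d -> Rabs (g y) <= B) ->
  g e = 0 -> g (e + 2 * d) = 0 ->
  forall t, e <= t <= e + 2 * d -> Rabs (g t) <= W.
Proof.
  intros he hd hW hB h0 h2.
  assert (hW0 : 0 <= W).
  { eapply Rle_trans; [apply Rabs_pos | apply (hW e d); lra]. }
  (* Reflecting the nearer endpoint, a zero of [g], through [t]. *)
  assert (improve : forall m,
    (forall y, e <= y <= e + 2 * d -> Rabs (g y) <= m) ->
    forall t, e <= t <= e + 2 * d -> Rabs (g t) <= (W + m) / 2).
  { intros m hm t ht.
    assert (0 <= m).
    { eapply Rle_trans; [apply Rabs_pos | apply (hm e); lra]. }
    destruct (Rle_dec t (e + d)) as [hl | hl].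
    - destruct (Req_dec t e) as [-> | hne]; [rewrite h0, Rabs_R0; lra|].
      assert (h1 := hW e (t - e) he ltac:(lra)).
      assert (h3 := hm (e + 2 * (t - e)) ltac:(lra)).
      replace (e + (t - e)) with t in h1 by ring.
      rewrite h0 in h1.
      revert h1 h3; unfold Rabs; repeat destruct Rcase_abs; lra.
    - destruct (Req_dec t (e + 2 * d)) as [-> | hne]; [rewrite h2, Rabs_R0; lra|].
      set (h := e + 2 * d - t).
      assert (h1 := hW (t - h) h ltac:(unfold h; lra) ltac:(unfold h; lra)).
      assert (h3 := hm (t - h) ltac:(unfold h; lra)).
      replace (t - h + 2 * h) with (e + 2 * d) in h1 by (unfold h; ring).
      replace (t - h + h) with t in h1 by ring.
      rewrite h2 in h1.
      revert h1 h3; unfold Rabs; repeat destruct Rcase_abs; lra. }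
  destruct (completeness (fun r => exists y, e <= y <= e + 2 * d /\ r = Rabs (g y)))
    as [m [hub hlub]].
  - exists B. intros r (y & hy & ->). now apply hB.
  - exists (Rabs (g e)), e. split; [lra | reflexivity].
  - assert (hm : forall y, e <= y <= e + 2 * d -> Rabs (g y) <= m).
    { intros y hy. apply hub. now exists y. }
    assert (m <= (W + m) / 2).
    { apply hlub. intros r (y & hy & ->). now apply improve. }
    intros t ht. specialize (hm t ht). lra.
Qed.

(** Value and increment are bounded together: one step of length [d] changes the increment by at
    most [W], and [(2 + m)^2 + (3 + m) <= (3 + m)^2] absorbs it. The base case has both points in
    [[e, e + 2d]], hence an increment of at most [2 W]. *)
Lemma growth_right (g : R -> R) (e d W : R) :
  0 <= e -> 0 < d -> second_diff_le g d W ->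
  (forall y, e <= y <= e + 2 * d -> Rabs (g y) <= W) ->
  forall m t, e + d <= t - INR m * d <= e + 2 * d ->
    Rabs (g t) <= W * (2 + INR m) ^ 2 /\ Rabs (g t - g (t - d)) <= (2 + INR m) * W.
Proof.
  intros he hd hW hB.
  assert (hW0 : 0 <= W).
  { eapply Rle_trans; [apply Rabs_pos | apply (hW e d); lra]. }
  induction m as [|m IH]; intros t ht.
  - simpl in *. assert (h1 := hB t ltac:(lra)). assert (h2 := hB (t - d) ltac:(lra)).
    split; revert h1 h2; unfold Rabs; repeat destruct Rcase_abs; lra.
  - assert (hm := pos_INR m).
    rewrite S_INR in *.
    assert (0 <= INR m * d) by nra.
    destruct (IH (t - d) ltac:(lra)) as [h1 h2].
    assert (h3 := hW (t - 2 * d) d ltac:(lra) ltac:(lra)).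
    replace (t - 2 * d + 2 * d) with t in h3 by ring.
    replace (t - 2 * d + d) with (t - d) in h3 by ring.
    replace (t - d - d) with (t - 2 * d) in h2 by ring.
    assert (h4 : Rabs (g t - g (t - d)) <= (2 + (INR m + 1)) * W).
    { revert h2 h3; unfold Rabs; repeat destruct Rcase_abs; lra. }
    split; [|exact h4].
    apply Rle_trans with (W * (2 + INR m) ^ 2 + (2 + (INR m + 1)) * W); [|nra].
    revert h1 h4; unfold Rabs; repeat destruct Rcase_abs; lra.
Qed.

(** The mirror image of [growth_right]; the steps now head for the boundary, so [0 <= t] must be
    carried along. *)
Lemma growth_left (g : R -> R) (e d W : R) :
  0 <= e -> 0 < d -> second_diff_le g d W ->
  (forall y, e <= y <= e + 2 * d -> Rabs (g y) <= W) ->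
  forall m t, 0 <= t -> e <= t + INR m * d <= e + d ->
    Rabs (g t) <= W * (2 + INR m) ^ 2 /\ Rabs (g t - g (t + d)) <= (2 + INR m) * W.
Proof.
  intros he hd hW hB.
  assert (hW0 : 0 <= W).
  { eapply Rle_trans; [apply Rabs_pos | apply (hW e d); lra]. }
  induction m as [|m IH]; intros t h0 ht.
  - simpl in *. assert (h1 := hB t ltac:(lra)). assert (h2 := hB (t + d) ltac:(lra)).
    split; revert h1 h2; unfold Rabs; repeat destruct Rcase_abs; lra.
  - assert (hm := pos_INR m).
    rewrite S_INR in *.
    destruct (IH (t + d) ltac:(lra) ltac:(lra)) as [h1 h2].
    assert (h3 := hW t d h0 ltac:(lra)).
    replace (t + d + d) with (t + 2 * d) in h2 by ring.
    assert (h4 : Rabs (g t - g (t + d)) <= (2 + (INR m + 1)) * W).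
    { revert h2 h3; unfold Rabs; repeat destruct Rcase_abs; lra. }
    split; [|exact h4].
    apply Rle_trans with (W * (2 + INR m) ^ 2 + (2 + (INR m + 1)) * W); [|nra].
    revert h1 h4; unfold Rabs; repeat destruct Rcase_abs; lra.
Qed.

Lemma affine_approximation (f : R -> R) (e d W B : R) :
  0 <= e -> 0 < d -> second_diff_le f d W ->
  (forall y, 0 <= y -> Rabs (f y) <= B) ->
  exists l, forall t, 0 <= t ->
    Rabs (f t - f e - l * (t - e)) <= 18 * W * (1 + ((t - e) / d) ^ 2).
Proof.
  intros he hd hW hB.
  exists ((f (e + 2 * d) - f e) / (2 * d)).
  set (l := (f (e + 2 * d) - f e) / (2 * d)).
  set (g := fun t => f t - f e - l * (t - e)).
  assert (hW0 : 0 <= W).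
  { eapply Rle_trans; [apply Rabs_pos | apply (hW e d); lra]. }
  assert (hWg : second_diff_le g d W).
  { intros y h hy hh. unfold g.
    replace (_ - _ + _) with (f (y + 2 * h) - 2 * f (y + h) + f y) by ring.
    now apply hW. }
  assert (hbase : forall y, e <= y <= e + 2 * d -> Rabs (g y) <= W).
  { apply (abs_le_of_second_diff g e d W (B + B + Rabs l * (2 * d))); trivial.
    - intros y hy. unfold g.
      assert (h1 := hB y ltac:(lra)). assert (h2 := hB e he).
      assert (h3 : Rabs (l * (y - e)) <= Rabs l * (2 * d)).
      { rewrite Rabs_mult, (Rabs_pos_eq (y - e)) by lra.
        apply Rmult_le_compat_l; [apply Rabs_pos | lra]. }
      revert h1 h2 h3. generalize (Rabs l * (2 * d)) (l * (y - e)).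
      intros r s; unfold Rabs; repeat destruct Rcase_abs; lra.
    - unfold g. ring.
    - unfold g, l. field. lra. }
  intros t ht. change (Rabs (g t) <= 18 * W * (1 + ((t - e) / d) ^ 2)).
  set (u := (t - e) / d).
  assert (hu : t - e = u * d) by (unfold u; field; lra).
  destruct (Rle_dec e t) as [hle | hlt].
  - destruct (Rle_dec (e + d) t) as [hle2 | hlt2].
    (* Here [m] steps to the left land in [[e + d, e + 2d]], and [2 + m <= 1 + u]. *)
    + destruct (nfloor_ex (u - 1)) as [m [hm1 hm2]].
      { apply Rmult_le_reg_r with d; lra. }
      assert (hm := pos_INR m).
      destruct (growth_right g e d W he hd hWg hbase m t) as [h _]; [nra|].
      apply Rle_trans with (1 := h).
      assert ((2 + INR m) ^ 2 <= 18 * (1 + u ^ 2)) by nra.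
      nra.
    + apply Rle_trans with (1 := hbase t ltac:(lra)).
      assert (0 <= u ^ 2) by apply pow2_ge_0. nra.
  - destruct (nfloor_ex (- u)) as [m [hm1 hm2]].
    { apply Rmult_le_reg_r with d; lra. }
    assert (hm := pos_INR m).
    (* With [m] the floor of [- u], it takes [m + 1] steps to land in [[e, e + d]]; the resulting
       factor is [3 + m <= 3 - u]. *)
    destruct (growth_left g e d W he hd hWg hbase (S m) t ht) as [h _].
    { rewrite S_INR. nra. }
    rewrite S_INR in h.
    apply Rle_trans with (1 := h).
    assert ((2 + (INR m + 1)) ^ 2 <= (3 - u) ^ 2) by (apply pow_incr; lra).
    assert ((3 - u) ^ 2 <= 18 * (1 + u ^ 2)) by nra.
    nra.
Qed.

(** * The moduli as suprema of bounded sets *)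

(** [real] sends both infinities to 0. The bound [B] excludes [p_infty] and the member [r] excludes
    [m_infty], so the supremum is a genuine real number. *)
Lemma real_Lub_Rbar_ge (E : R -> Prop) (B r : R) :
  (forall s, E s -> s <= B) -> E r -> r <= real (Lub_Rbar E).
Proof.
  intros hB hr.
  destruct (Lub_Rbar_correct E) as [h1 h2].
  assert (h3 := h2 (Finite B) hB). assert (h4 := h1 r hr).
  destruct (Lub_Rbar E); simpl in *; tauto.
Qed.

Lemma le_modulus1 (f : R -> R) (B d x t : R) :
  (forall y, 0 <= y -> Rabs (f y) <= B) -> 0 <= x -> 0 <= t -> Rabs (t - x) <= d ->
  Rabs (f t - f x) <= modulus1 f d.
Proof.
  intros hB hx ht hd. unfold modulus1. apply real_Lub_Rbar_ge with (B + B).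
  - intros s (y & z & hy & hz & _ & ->).
    generalize (hB y hy) (hB z hz).
    unfold Rabs; repeat destruct Rcase_abs; lra.
  - now exists x, t.
Qed.

Lemma second_diff_le_modulus2 (f : R -> R) (B d : R) :
  (forall y, 0 <= y -> Rabs (f y) <= B) -> second_diff_le f d (modulus2 f d).
Proof.
  intros hB x h hx hh. unfold modulus2. apply real_Lub_Rbar_ge with (4 * B).
  - intros s (k & y & hk & _ & hy & ->).
    generalize (hB y hy) (hB (y + k) ltac:(lra)) (hB (y + 2 * k) ltac:(lra)).
    unfold Rabs; repeat destruct Rcase_abs; lra.
  - exists h, x. repeat split; lra.
Qed.

(** No [h] satisfies [0 < h <= 0], so the supremum is over the empty set: it is [m_infty], which
    [real] turns into 0. This serves the point [x = 0]. *)
Lemma modulus2_0 (f : R -> R) : modulus2 f 0 = 0.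
Proof.
  unfold modulus2.
  rewrite (is_lub_Rbar_unique _ m_infty); [reflexivity|].
  split.
  - intros r (h & x & h1 & h2 & _). lra.
  - intros b _. now destruct b.
Qed.

(** * The Jain weights *)

Lemma exp_le_exp (x y : R) : x <= y -> exp x <= exp y.
Proof.
  intros [h | ->]; [apply Rlt_le, exp_increasing, h | apply Rle_refl].
Qed.

(* Unlike [omega_beta], whose exponent [v - 1] is truncated at [v = 0], this is
   the genuine Jain weight at [v = 0]. *)
Definition jain (b : R) (v : nat) (y : R) : R :=
  match v with O => exp (- y) | S _ => omega_beta b v y end.

Lemma jain_ge0 (b : R) (v : nat) (y : R) : 0 <= b -> 0 <= y -> 0 <= jain b v y.
Proof.
  intros hb hy. destruct v as [|v]; [apply Rlt_le, exp_pos|].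
  unfold jain, omega_beta.
  assert (hv := pos_INR (S v)).
  apply Rmult_le_pos; [|apply Rlt_le, Rinv_0_lt_compat, INR_fact_lt_0].
  apply Rmult_le_pos; [|apply Rlt_le, exp_pos].
  apply Rmult_le_pos; [exact hy|]. apply pow_le. nra.
Qed.

Lemma is_derive_jain_S (b : R) (v : nat) (y : R) :
  is_derive (jain b (S v)) y (jain b v (y + b) - jain b (S v) y).
Proof.
  unfold jain, omega_beta.
  assert (hS := S_INR v).
  destruct v as [|v].
  - simpl. auto_derive; [trivial|].
    replace (- (y + b)) with (- (y + 1 * b)) by ring. field.
  - replace (S (S v) - 1)%nat with (S v) by lia.
    replace (S v - 1)%nat with v by lia.
    replace (y + b + INR (S v) * b) with (y + INR (S (S v)) * b) by (rewrite (S_INR (S v)); ring).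
    change (Factorial.fact (S (S v))) with (S (S v) * Factorial.fact (S v))%nat.
    rewrite mult_INR.
    assert (hf := INR_fact_neq_0 (S v)).
    assert (hm : y + b = y + INR (S (S v)) * b - INR (S v) * b) by (rewrite (S_INR (S v)); ring).
    assert (hv := pos_INR (S v)).
    revert hS hf hm hv.
    generalize (INR (Factorial.fact (S v))) (INR (S (S v))).
    intros F w hS hf hm hv.
    auto_derive; [trivial|].
    rewrite hm. change (Init.Nat.pred (S v)) with v.
    change (match v with O => 1 | S _ => INR v + 1 end) with (INR (S v)).
    replace (INR (S v)) with (w - 1) in * by lra.
    simpl pow. field. lra.
Qed.

Definition jain_tail (b : R) (N : nat) (y : R) : R := 1 - sum_n (fun v => jain b v y) N.

Lemma jain_tail_at_0 (b : R) (N : nat) : jain_tail b N 0 = 0.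
Proof.
  unfold jain_tail. induction N as [|N IH].
  - rewrite sum_O. simpl. rewrite Ropp_0, exp_0. ring.
  - rewrite sum_Sn. unfold plus; simpl. unfold omega_beta.
    unfold Rdiv; rewrite !Rmult_0_l. lra.
Qed.

Lemma is_derive_jain_tail_S (b : R) (N : nat) (y : R) :
  is_derive (jain_tail b (S N)) y (jain_tail b N (y + b) - jain_tail b (S N) y).
Proof.
  unfold jain_tail.
  assert (h : is_derive (fun y => sum_n (fun v => jain b v y) (S N)) y
                (sum_n (fun v => jain b v (y + b)) N - sum_n (fun v => jain b v y) (S N))).
  { induction N as [|N IH].
    - rewrite sum_Sn, !sum_O.
      apply is_derive_ext with (fun y => exp (- y) + jain b 1 y).
      { intros t. now rewrite sum_Sn, sum_O. }
      evar_last.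
      { apply (is_derive_plus (V := R_NormedModule) (fun y => exp (- y)) (jain b 1) y (- exp (- y)));
          [auto_derive; [trivial | ring] | apply is_derive_jain_S]. }
      unfold plus; simpl. ring.
    - rewrite !(sum_Sn _ (S N)), (sum_Sn _ N).
      eapply is_derive_ext; [intros t; symmetry; apply sum_Sn|].
      evar_last; [apply (is_derive_plus (V := R_NormedModule)); [exact IH | apply is_derive_jain_S]|].
      unfold plus; simpl. ring. }
  evar_last; [apply (is_derive_minus (V := R_NormedModule) (fun _ => 1)); [apply is_derive_const | exact h]|].
  unfold minus, plus, opp, zero; simpl. ring.
Qed.

(** The function [exp t * F t] has derivative [exp t * (F' + F) >= 0], so it never falls below its
    initial value [F 0]. *)
Lemma nonneg_of_relaxation (F dF : R -> R) :
  0 <= F 0 -> (forall y, is_derive F y (dF y)) ->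
  (forall y, 0 <= y -> 0 <= dF y + F y) ->
  forall y, 0 <= y -> 0 <= F y.
Proof.
  intros h0 hd hp y hy.
  assert (hder : forall t, is_derive (fun t => exp t * F t) t (exp t * (dF t + F t))).
  { intros t. evar_last.
    - apply (is_derive_mult exp F t (exp t) (dF t)); [apply is_derive_exp | apply hd | apply Rmult_comm].
    - unfold plus, mult; simpl. ring. }
  destruct (MVT_gen (fun t => exp t * F t) 0 y (fun t => exp t * (dF t + F t)))
    as (z & hz & heq).
  - intros t _. apply hder.
  - intros t _. apply continuity_pt_filterlim.
    apply (ex_derive_continuous (V := R_NormedModule) (fun t => exp t * F t)).
    eexists. apply hder.
  - rewrite Rmin_left, Rmax_right in hz by lra.
    rewrite exp_0 in heq.
    assert (h1 := hp z ltac:(lra)).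
    assert (h2 := exp_pos z). assert (h3 := exp_pos y).
    assert (0 <= exp z * (dF z + F z) * (y - 0)).
    { apply Rmult_le_pos; [apply Rmult_le_pos|]; lra. }
    apply Rmult_le_reg_l with (exp y); [exact h3|]. lra.
Qed.

(* [exp (lam * y)] is a supersolution of the recursion satisfied by the tails, of
   contraction ratio [rho < 1]. *)
Definition lam (b : R) : R := 1 - b.
Definition rho (b : R) : R := exp (lam b * b) / (1 + lam b).

(** With [s = (1 - b) * b], the inequality [exp s <= 1 / (1 - s)] reduces the upper bound to
    [(2 - b) * (1 - s) > 1], and the left side equals [1 + (1 - b)^3]. *)
Lemma rho_bounds (b : R) : 0 <= b < 1 -> 0 < rho b < 1.
Proof.
  intros hb. unfold rho, lam.
  assert (hl : 0 < 1 - (1 - b) * b) by nra.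
  split; [apply Rdiv_lt_0_compat; [apply exp_pos | lra]|].
  apply Rmult_lt_reg_r with (1 + (1 - b)); [lra|].
  unfold Rdiv; rewrite Rmult_assoc, Rinv_l, Rmult_1_r, Rmult_1_l by lra.
  apply Rle_lt_trans with (/ (1 - (1 - b) * b)).
  - rewrite <- (Ropp_involutive ((1 - b) * b)) at 1. rewrite exp_Ropp.
    apply Rinv_le_contravar; [exact hl|].
    generalize (exp_ineq1_le (- ((1 - b) * b))). lra.
  - apply Rmult_lt_reg_r with (1 - (1 - b) * b); [exact hl|].
    rewrite Rinv_l by lra.
    assert (0 < (1 - b) ^ 3) by (apply pow_lt; lra). lra.
Qed.

Lemma jain_tail_bounds (b : R) (N : nat) : 0 <= b < 1 ->
  forall y, 0 <= y -> 0 <= jain_tail b N y <= rho b ^ N * exp (lam b * y).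
Proof.
  intros hb. assert (hr := rho_bounds b hb).
  induction N as [|N IH]; intros y hy.
  - unfold jain_tail. rewrite sum_O. simpl jain. simpl pow.
    assert (h1 : exp (- y) <= 1) by (rewrite <- exp_0; apply exp_le_exp; lra).
    assert (h2 : 1 <= exp (lam b * y)).
    { rewrite <- exp_0. apply exp_le_exp. unfold lam. nra. }
    assert (h3 := exp_pos (- y)). lra.
  - split.
    + apply (nonneg_of_relaxation (jain_tail b (S N))
               (fun y => jain_tail b N (y + b) - jain_tail b (S N) y)); trivial.
      * rewrite jain_tail_at_0; lra.
      * apply is_derive_jain_tail_S.
      * intros z hz. destruct (IH (z + b)); lra.
    + apply Rminus_le_0.
      apply (nonneg_of_relaxation
               (fun y => rho b ^ S N * exp (lam b * y) - jain_tail b (S N) y)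
               (fun y => rho b ^ S N * (lam b * exp (lam b * y))
                         - (jain_tail b N (y + b) - jain_tail b (S N) y))); trivial.
      * rewrite jain_tail_at_0, Rmult_0_r, exp_0.
        assert (0 < rho b ^ S N) by (apply pow_lt; lra). lra.
      * intros z.
        apply (is_derive_minus (V := R_NormedModule)); [|apply is_derive_jain_tail_S].
        auto_derive; [trivial | simpl; ring].
      * intros z hz. destruct (IH (z + b)) as [_ h]; [lra|].
        (* The choice of [rho] makes [H_N = rho^N * exp (lam * y)] solve the tail recursion
           [H_(N+1)' + H_(N+1) = H_N(. + b)] exactly, so the difference with the tail satisfies the
           hypothesis of [nonneg_of_relaxation]. *)
        assert (heq : rho b ^ S N * (1 + lam b) * exp (lam b * z)
                      = rho b ^ N * exp (lam b * (z + b))).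
        { replace (lam b * (z + b)) with (lam b * b + lam b * z) by ring.
          rewrite exp_plus.
          assert (hexp : exp (lam b * b) = rho b * (1 + lam b)) by (unfold rho; field; unfold lam; lra).
          rewrite hexp. simpl pow. ring. }
        lra.
Qed.

Lemma is_series_jain (b y : R) : 0 <= b < 1 -> 0 <= y -> is_series (fun v => jain b v y) 1.
Proof.
  intros hb hy. assert (hr := rho_bounds b hb).
  assert (h : is_lim_seq (sum_n (fun v => jain b v y)) 1); [|exact h].
  apply is_lim_seq_le_le with (fun N => 1 - rho b ^ N * exp (lam b * y)) (fun _ => 1).
  - intros N. assert (h := jain_tail_bounds b N hb y hy). unfold jain_tail in h. lra.
  - evar_last.
    + apply is_lim_seq_minus'; [apply is_lim_seq_const|].
      apply is_lim_seq_mult'; [|apply is_lim_seq_const].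
      apply is_lim_seq_geom. rewrite Rabs_pos_eq; lra.
    + simpl. f_equal. ring.
  - apply is_lim_seq_const.
Qed.

(** The weight of index [k + 1] is the difference of the tails [R_k] and [R_(k+1)]; since
    [R_(k+1) >= 0], it is at most [R_k]. *)
Lemma omega_beta_S_bounds (b y : R) (k : nat) : 0 <= b < 1 -> 0 <= y ->
  0 <= omega_beta b (S k) y <= rho b ^ k * exp (lam b * y).
Proof.
  intros hb hy. split; [apply (jain_ge0 b (S k)); lra|].
  destruct (jain_tail_bounds b k hb y hy) as [_ h1].
  destruct (jain_tail_bounds b (S k) hb y hy) as [h2 _].
  unfold jain_tail in *. rewrite sum_Sn in h2. unfold plus in h2; simpl in h2. lra.
Qed.

Lemma is_series_omega_beta (b y : R) : 0 <= b < 1 -> 0 <= y ->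
  is_series (fun k => omega_beta b (S k) y) (1 - exp (- y)).
Proof.
  intros hb hy.
  assert (h := is_series_incr_1 (fun v => jain b v y) (1 - exp (- y))).
  apply h. evar_last; [apply is_series_jain; trivial|].
  unfold plus, opp; simpl. ring.
Qed.

(* The series [S z = sum_k (z + k b)^k exp (- (z + k b)) / k!], with
   [sum_v v * omega_beta b v y = y * S (y + b)] and [S z = 1 + b * S (z + b)]. *)
Lemma omega_beta_moment_ge (b y : R) : 0 <= b < 1 -> 0 < y ->
  ex_series (fun k => INR (S k) * omega_beta b (S k) y) ->
  y <= Series (fun k => INR (S k) * omega_beta b (S k) y).
Proof.
  intros hb hy hex.
  set (z := y + b).
  assert (hz : 0 < z) by (unfold z; lra).
  (* Replacing one factor [z + k b] by the smaller [z] turns the [k]-th term of [S z] into a Jain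
     weight at [z], and those weights sum to 1. *)
  assert (hterm : forall k, y * jain b k z <= INR (S k) * omega_beta b (S k) y).
  { intros k. unfold omega_beta.
    replace (S k - 1)%nat with k by lia.
    replace (y + INR (S k) * b) with (z + INR k * b) by (unfold z; rewrite S_INR; ring).
    change (Factorial.fact (S k)) with (S k * Factorial.fact k)%nat. rewrite mult_INR.
    assert (hk := pos_INR k). assert (hf := INR_fact_lt_0 k).
    assert (hS : INR (S k) <> 0) by (rewrite S_INR; lra).
    replace (INR (S k) * _) with
      (y * ((z + INR k * b) ^ k * exp (- (z + INR k * b)) / INR (Factorial.fact k))) by (field; lra).
    apply Rmult_le_compat_l; [lra|].
    destruct k as [|k].
    - simpl. unfold Rdiv. rewrite Rmult_0_l, Rplus_0_r, Rinv_1. lra.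
    - unfold jain, omega_beta. replace (S k - 1)%nat with k by lia.
      apply Rmult_le_compat_r; [apply Rlt_le, Rinv_0_lt_compat, hf|].
      apply Rmult_le_compat_r; [apply Rlt_le, exp_pos|].
      assert (0 <= INR (S k) * b) by (apply Rmult_le_pos; lra).
      change ((z + INR (S k) * b) ^ S k) with ((z + INR (S k) * b) * (z + INR (S k) * b) ^ k).
      apply Rmult_le_compat_r; [apply pow_le|]; lra. }
  rewrite <- (Rmult_1_r y) at 1.
  rewrite <- (is_series_unique _ _ (is_series_jain b z hb ltac:(lra))).
  rewrite <- Series_scal_l.
  apply Series_le; [|exact hex].
  intros k. split; [|apply hterm].
  apply Rmult_le_pos; [lra | apply jain_ge0; lra].
Qed.

Lemma ex_series_quadratic_geometric (r : R) : 0 < r < 1 ->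
  ex_series (fun k => (INR k + 1) * (INR k + 2) * r ^ k).
Proof.
  intros hr.
  assert (hpos : forall k, 0 < (INR k + 1) * (INR k + 2) * r ^ k).
  { intros k. assert (hk := pos_INR k).
    apply Rmult_lt_0_compat; [nra | apply pow_lt; lra]. }
  apply ex_series_ext with (fun k => Rabs ((INR k + 1) * (INR k + 2) * r ^ k)).
  { intros k. apply Rabs_pos_eq, Rlt_le, hpos. }
  apply (ex_series_DAlembert _ r); [lra | intros k; generalize (hpos k); lra |].
  (* The quotient of consecutive terms is [r * (k + 3) / (k + 1)]. *)
  apply is_lim_seq_ext with (fun k => r + 2 * r * / (INR (S k))).
  { intros k. assert (hk := pos_INR k).
    rewrite Rabs_pos_eq by (apply Rlt_le, Rdiv_lt_0_compat; apply hpos).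
    rewrite S_INR. simpl pow. field.
    split; [apply pow_nonzero; lra | lra]. }
  evar_last.
  - apply is_lim_seq_plus'; [apply is_lim_seq_const|].
    apply is_lim_seq_mult'; [apply is_lim_seq_const|].
    apply (is_lim_seq_incr_1 (fun k => / INR k)).
    apply (is_lim_seq_inv INR p_infty is_lim_seq_INR). discriminate.
  - simpl. f_equal. ring.
Qed.

(** * Improper integrals and the Gamma function *)

Notation is_RInt_inf f l := (is_RInt_gen f (at_point 0) (Rbar_locally p_infty) l).
Notation ex_RInt_inf f := (ex_RInt_gen f (at_point 0) (Rbar_locally p_infty)).
Notation RInt_inf f := (RInt_gen f (at_point 0) (Rbar_locally p_infty)).

Lemma filter_prod_pos (P : R * R -> Prop) :
  (forall b, 0 < b -> P (0, b)) -> filter_prod (at_point 0) (Rbar_locally p_infty) P.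
Proof.
  intros h. exists (fun a => a = 0) (fun b => 0 < b); [reflexivity | now exists 0 |].
  intros a b -> hb. now apply h.
Qed.

Lemma is_RInt_inf_intro (f I : R -> R) (l : R) :
  (forall b, 0 < b -> is_RInt f 0 b (I b)) -> is_lim I p_infty l -> is_RInt_inf f l.
Proof.
  intros hI hl P hP. destruct (hl P hP) as [M hM].
  exists (fun a => a = 0) (fun b => Rmax 0 M < b); [reflexivity | now exists (Rmax 0 M) |].
  intros a b -> hb. simpl.
  assert (h1 := Rmax_l 0 M). assert (h2 := Rmax_r 0 M).
  exists (I b). split; [apply hI; lra | apply hM; lra].
Qed.

Lemma is_RInt_inf_lim (f : R -> R) (l : R) :
  is_RInt_inf f l -> is_lim (fun b => RInt f 0 b) p_infty l.
Proof.
  intros h P hP. destruct (h P hP) as [Q S hQ [M hM] hQS].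
  exists M. intros b hb.
  destruct (hQS 0 b hQ (hM b hb)) as (y & hy & hPy). simpl in *.
  now rewrite (is_RInt_unique _ _ _ _ hy).
Qed.

(** Agreement at [t = 0] is deliberately not asked for: this is what allows an integrand to be
    redefined at the origin. *)
Lemma is_RInt_inf_ext (f g : R -> R) (l : R) :
  (forall t, 0 < t -> f t = g t) -> is_RInt_inf f l -> is_RInt_inf g l.
Proof.
  intros h. apply is_RInt_gen_ext, filter_prod_pos.
  intros b hb x hx. simpl in hx. rewrite Rmin_left in hx by lra. apply h; lra.
Qed.

Lemma RInt_inf_ext (f g : R -> R) :
  (forall t, 0 < t -> f t = g t) -> ex_RInt_inf f -> RInt_inf f = RInt_inf g.
Proof.
  intros h. apply (RInt_gen_ext (V := R_CompleteNormedModule)), filter_prod_pos.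
  intros b hb x hx. simpl in hx. rewrite Rmin_left in hx by lra. apply h; lra.
Qed.

Lemma is_RInt_inf_unique (f : R -> R) (l : R) : is_RInt_inf f l -> RInt_inf f = l.
Proof. apply (is_RInt_gen_unique (V := R_CompleteNormedModule)). Qed.

Lemma is_RInt_inf_primitive (F f : R -> R) (l : R) :
  (forall t, 0 <= t -> is_derive F t (f t)) ->
  (forall t, 0 <= t -> continuous f t) ->
  is_lim F p_infty l -> is_RInt_inf f (l - F 0).
Proof.
  intros hd hc hl. apply is_RInt_inf_intro with (fun b => F b - F 0).
  - intros b hb. apply (is_RInt_derive (V := R_CompleteNormedModule) F f);
      rewrite Rmin_left, Rmax_right by lra; intros t ht; [apply hd | apply hc]; lra.
  - apply is_lim_minus'; [exact hl | apply is_lim_const].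
Qed.

Lemma ex_RInt_of_continuous (f : R -> R) (a b : R) :
  (forall t, 0 <= t -> continuous f t) -> 0 <= a -> 0 <= b -> ex_RInt f a b.
Proof.
  intros hc ha hb. apply (ex_RInt_continuous (V := R_CompleteNormedModule)).
  intros z hz. apply hc. generalize (Rmin_glb a b 0 ha hb). lra.
Qed.

Lemma RInt_sub (f : R -> R) (a b : R) :
  (forall t, 0 <= t -> continuous f t) -> 0 <= a -> 0 <= b ->
  RInt f 0 b - RInt f 0 a = RInt f a b.
Proof.
  intros hc ha hb.
  assert (h := RInt_Chasles (V := R_CompleteNormedModule) f 0 a b
    (ex_RInt_of_continuous f 0 a hc (Rle_refl 0) ha) (ex_RInt_of_continuous f a b hc ha hb)).
  unfold plus in h; simpl in h. lra.
Qed.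

(** Increments of the partial integrals of [f] are bounded by those of [g], so the Cauchy criterion
    passes from [g] to [f]. *)
Lemma ex_RInt_inf_dominated (f g : R -> R) :
  (forall t, 0 <= t -> continuous f t) -> (forall t, 0 <= t -> continuous g t) ->
  (forall t, 0 <= t -> Rabs (f t) <= g t) -> ex_RInt_inf g -> ex_RInt_inf f.
Proof.
  intros hf hg hle [L hL]. apply is_RInt_inf_lim in hL.
  destruct (proj1 (filterlim_locally_cauchy (U := R_CompleteSpace)
    (F := Rbar_locally p_infty) (fun b => RInt f 0 b))) as [l hl].
  - intros eps.
    destruct (proj2 (filterlim_locally_cauchy (U := R_CompleteSpace)
      (F := Rbar_locally p_infty) (fun b => RInt g 0 b)) (ex_intro _ L hL) eps)
      as (P & [M hM] & hP).
    exists (fun b => Rmax 0 M < b). split; [now exists (Rmax 0 M)|].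
    assert (hwlog : forall u v, Rmax 0 M < u -> u <= v ->
      Rabs (RInt f 0 v - RInt f 0 u) < eps).
    { intros u v hu huv.
      assert (h1 := Rmax_l 0 M). assert (h2 := Rmax_r 0 M).
      assert (hb : Rabs (RInt g 0 v - RInt g 0 u) < eps) by (apply (hP u v); apply hM; lra).
      rewrite RInt_sub in hb |- * by (trivial; lra).
      apply Rle_lt_trans with (RInt g u v).
      - apply (norm_RInt_le (V := R_NormedModule) f g u v); [exact huv | | |].
        + intros x hx. apply hle. lra.
        + apply (RInt_correct (V := R_CompleteNormedModule)), ex_RInt_of_continuous; trivial; lra.
        + apply (RInt_correct (V := R_CompleteNormedModule)), ex_RInt_of_continuous; trivial; lra.
      - apply Rle_lt_trans with (2 := hb), Rle_abs. }
    intros u v hu hv.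
    change (Rabs (RInt f 0 v - RInt f 0 u) < eps).
    destruct (Rle_dec u v).
    + now apply hwlog.
    + rewrite Rabs_minus_sym. apply hwlog; lra.
  - exists l. apply is_RInt_inf_intro with (fun b => RInt f 0 b); [|exact hl].
    intros b hb. apply (RInt_correct (V := R_CompleteNormedModule)), ex_RInt_of_continuous; trivial; lra.
Qed.

Lemma RInt_le_is_RInt_inf (f : R -> R) (l b : R) :
  (forall t, 0 <= t -> continuous f t) -> (forall t, 0 <= t -> 0 <= f t) ->
  is_RInt_inf f l -> 0 <= b -> RInt f 0 b <= l.
Proof.
  intros hc hp hl hb. apply is_RInt_inf_lim in hl.
  change (Rbar_le (RInt f 0 b) l).
  apply (is_lim_le_loc (fun _ => RInt f 0 b) (fun b => RInt f 0 b) p_infty);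
    [ | apply is_lim_const | exact hl].
  exists b. intros u hu.
  generalize (RInt_sub f b u hc hb ltac:(lra)).
  assert (0 <= RInt f b u); [|lra].
  apply RInt_ge_0; [lra | apply ex_RInt_of_continuous; trivial; lra|].
  intros x hx; apply hp; lra.
Qed.

Lemma is_RInt_inf_le (f g : R -> R) (lf lg : R) :
  (forall t, 0 <= t -> f t <= g t) -> is_RInt_inf f lf -> is_RInt_inf g lg -> lf <= lg.
Proof.
  intros h hf hg.
  assert (hd := is_RInt_gen_minus g f lg lf hg hf).
  (* The nonnegative function [g - f] is its own majorant, which gives [|lg - lf| <= lg - lf]. *)
  assert (ha : norm (minus lg lf) <= minus lg lf).
  { apply (RInt_gen_norm (Fa := at_point 0) (Fb := Rbar_locally p_infty)
      (fun t => minus (g t) (f t)) (fun t => minus (g t) (f t))); trivial.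
    - apply filter_prod_pos. simpl. intros b hb. lra.
    - apply filter_prod_pos. intros b hb x hx. simpl in hx.
      unfold norm, minus, plus, opp; simpl. unfold abs; simpl.
      rewrite Rabs_pos_eq; [lra|]. generalize (h x ltac:(lra)). lra. }
  unfold norm, minus, plus, opp in ha; simpl in ha; unfold abs in ha; simpl in ha.
  generalize (Rabs_pos (lg + - lf)). lra.
Qed.

(* [Rpower t y] is [1] at [t = 0]; [tpow] is the version that is continuous there. *)
Definition tpow (y t : R) : R := if Rle_dec t 0 then 0 else Rpower t y.

Lemma tpow_pos (y t : R) : 0 < t -> tpow y t = Rpower t y.
Proof. intros ht. unfold tpow. destruct (Rle_dec t 0); [lra | reflexivity]. Qed.

Lemma tpow_nonpos (y t : R) : t <= 0 -> tpow y t = 0.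
Proof. intros ht. unfold tpow. destruct (Rle_dec t 0); [reflexivity | lra]. Qed.

(** The delicate point is 0, where [2 <= y] gives [h^y <= h^2] for small [h > 0], hence derivative
    0. *)
Lemma is_derive_tpow (y t : R) : 2 <= y -> is_derive (tpow y) t (y * tpow (y - 1) t).
Proof.
  intros hy. destruct (total_order_T t 0) as [[ht | ->] | ht].
  - rewrite tpow_nonpos, Rmult_0_r by lra.
    apply is_derive_ext_loc with (fun _ => 0); [|apply (is_derive_const (V := R_NormedModule) 0)].
    apply (locally_interval _ t m_infty 0); simpl; trivial.
    intros z _ hz. rewrite tpow_nonpos; lra.
  - rewrite tpow_nonpos, Rmult_0_r by lra.
    apply is_derive_Reals. intros eps heps.
    assert (hd : 0 < Rmin 1 eps) by (apply Rmin_glb_lt; lra).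
    exists (mkposreal _ hd). simpl. intros h hne hh.
    assert (h1 := Rmin_l 1 eps). assert (h2 := Rmin_r 1 eps).
    rewrite (tpow_nonpos y 0) by lra. rewrite Rplus_0_l, !Rminus_0_r.
    destruct (Rle_dec h 0) as [hn | hp].
    + rewrite tpow_nonpos by lra. unfold Rdiv; rewrite Rmult_0_l, Rabs_R0; lra.
    + rewrite Rabs_pos_eq in hh by lra.
      rewrite tpow_pos by lra.
      assert (hb : Rpower h y <= h * h).
      { replace (h * h) with (Rpower h 2).
        - unfold Rpower. apply exp_le_exp.
          assert (ln h <= 0) by (rewrite <- ln_1; apply Rcomplements.ln_le; lra). nra.
        - replace 2 with (1 + 1) by ring. rewrite Rpower_plus, Rpower_1; lra. }
      assert (hq : Rpower h y / h <= h).
      { apply Rmult_le_reg_r with h; [lra|].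
        unfold Rdiv. rewrite Rmult_assoc, Rinv_l; lra. }
      rewrite Rabs_pos_eq; [lra|].
      apply Rlt_le, Rdiv_lt_0_compat; [apply exp_pos | lra].
  - rewrite tpow_pos by lra.
    apply is_derive_ext_loc with (fun t => Rpower t y).
    { apply (locally_interval _ t 0 p_infty); simpl; trivial.
      intros z hz _. now rewrite tpow_pos. }
    apply is_derive_Reals, derivable_pt_lim_power, ht.
Qed.

Lemma continuous_tpow (y t : R) : 2 <= y -> continuous (tpow y) t.
Proof.
  intros hy. apply (ex_derive_continuous (V := R_NormedModule)).
  eexists. now apply is_derive_tpow.
Qed.

Lemma tpow_ge0 (y t : R) : 0 <= tpow y t.
Proof.
  unfold tpow. destruct (Rle_dec t 0); [lra | apply Rlt_le, exp_pos].
Qed.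

Lemma tpow_le_exp (y : R) : 2 <= y ->
  exists C, 0 <= C /\ forall t, tpow y t * exp (- t) <= C * exp (- (t / 2)).
Proof.
  (* The constant is the maximum of [t^y * exp (- t / 2)], attained at [t = 2 y]; it comes from
     [ln v <= v - 1] at [v = t / (2 y)]. *)
  intros hy. exists (exp (y * (ln (2 * y) - 1))). split; [apply Rlt_le, exp_pos|].
  intros t. destruct (Rle_dec t 0) as [hn | hp].
  - rewrite tpow_nonpos, Rmult_0_l by lra.
    apply Rmult_le_pos; apply Rlt_le, exp_pos.
  - rewrite tpow_pos by lra. unfold Rpower. rewrite <- !exp_plus.
    apply exp_le_exp.
    assert (hu : 0 < t / (2 * y)) by (apply Rdiv_lt_0_compat; lra).
    assert (h1 : ln (t / (2 * y)) <= t / (2 * y) - 1).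
    { generalize (exp_ineq1_le (ln (t / (2 * y)))). rewrite exp_ln; lra. }
    rewrite Rcomplements.ln_div in h1 by lra.
    apply (Rmult_le_compat_l y) in h1; [|lra].
    replace (y * (t / (2 * y) - 1)) with (t / 2 - y) in h1 by (field; lra).
    lra.
Qed.

Lemma is_lim_exp_half : is_lim (fun t => exp (- (t / 2))) p_infty 0.
Proof.
  apply (is_lim_comp exp (fun t => - (t / 2)) p_infty 0 m_infty).
  - apply is_lim_exp_m.
  - apply is_lim_ext with (fun t => (- / 2) * t); [intros t; field|].
    evar_last; [apply is_lim_scal_l, is_lim_id|].
    simpl. destruct (Rle_dec 0 (- / 2)) as [h | h]; [exfalso; lra | reflexivity].
  - now exists 0.
Qed.

Lemma is_lim_tpow_exp (y : R) : 2 <= y -> is_lim (fun t => tpow y t * exp (- t)) p_infty 0.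
Proof.
  intros hy. destruct (tpow_le_exp y hy) as (C & hC & hle).
  apply is_lim_le_le_loc with (fun _ => 0) (fun t => C * exp (- (t / 2))).
  - exists 0. intros t ht. split; [|apply hle].
    apply Rmult_le_pos; [apply tpow_ge0 | apply Rlt_le, exp_pos].
  - apply is_lim_const.
  - evar_last; [apply is_lim_scal_l, is_lim_exp_half | simpl; f_equal; ring].
Qed.

Lemma continuous_tpow_exp (y t : R) : 2 <= y -> continuous (fun t => tpow y t * exp (- t)) t.
Proof.
  intros hy. apply (continuous_mult (K := R_AbsRing)); [now apply continuous_tpow|].
  apply (ex_derive_continuous (V := R_NormedModule)). auto_derive. trivial.
Qed.

(** For [3 <= s] the exponent [s - 1] is at least 2, so [tpow] makes the integrand continuous at 0;
    the range covers the arguments [n / c + k]. *)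
Lemma is_RInt_inf_Gamma (s : R) : 3 <= s ->
  is_RInt_inf (fun t => tpow (s - 1) t * exp (- t)) (Gamma s).
Proof.
  intros hs.
  assert (hex : ex_RInt_inf (fun t => tpow (s - 1) t * exp (- t))).
  { destruct (tpow_le_exp (s - 1)) as (C & hC & hle); [lra|].
    apply ex_RInt_inf_dominated with (fun t => C * exp (- (t / 2))).
    - intros t _. apply continuous_tpow_exp. lra.
    - intros t _. apply (ex_derive_continuous (V := R_NormedModule)). auto_derive. trivial.
    - intros t _. rewrite Rabs_pos_eq; [apply hle|].
      apply Rmult_le_pos; [apply tpow_ge0 | apply Rlt_le, exp_pos].
    - eexists. apply (is_RInt_inf_primitive (fun t => - 2 * C * exp (- (t / 2)))).
      + intros t _. auto_derive; [trivial|]. unfold Rdiv; field.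
      + intros t _. apply (ex_derive_continuous (V := R_NormedModule)). auto_derive. trivial.
      + apply is_lim_scal_l with (l := 0), is_lim_exp_half. }
  unfold Gamma. rewrite <- (RInt_inf_ext (fun t => tpow (s - 1) t * exp (- t))); trivial.
  - now apply (RInt_gen_correct (V := R_CompleteNormedModule)).
  - intros t ht. now rewrite tpow_pos.
Qed.

Lemma Gamma_pos (s : R) : 3 <= s -> 0 < Gamma s.
Proof.
  intros hs. apply Rlt_le_trans with (RInt (fun t => tpow (s - 1) t * exp (- t)) 0 1).
  - apply RInt_gt_0; [lra | |].
    + intros t ht. rewrite tpow_pos by lra. apply Rmult_lt_0_compat; apply exp_pos.
    + intros t _. apply continuous_tpow_exp. lra.
  - apply RInt_le_is_RInt_inf; [| |now apply is_RInt_inf_Gamma | lra].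
    + intros t _. apply continuous_tpow_exp. lra.
    + intros t _. apply Rmult_le_pos; [apply tpow_ge0 | apply Rlt_le, exp_pos].
Qed.

(** Integration by parts: the derivative of [t^s * exp (- t)] is the difference of the two
    integrands, and its boundary values vanish. *)
Lemma Gamma_succ (s : R) : 3 <= s -> Gamma (s + 1) = s * Gamma s.
Proof.
  intros hs.
  assert (h1 := is_RInt_inf_Gamma s hs).
  assert (h2 := is_RInt_inf_Gamma (s + 1) ltac:(lra)).
  assert (h3 : is_RInt_inf (fun t => s * (tpow (s - 1) t * exp (- t))
                                     - tpow (s + 1 - 1) t * exp (- t))
                 (0 - tpow s 0 * exp (- 0))).
  { apply (is_RInt_inf_primitive (fun t => tpow s t * exp (- t))).
    - intros t _. evar_last.
      + apply (is_derive_mult (tpow s) (fun t => exp (- t)) t (s * tpow (s - 1) t) (- exp (- t)));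
          [apply is_derive_tpow; lra | auto_derive; [trivial | ring] | apply Rmult_comm].
      + unfold plus, mult; simpl. replace (s + 1 - 1) with s by ring. ring.
    - intros t _. apply (continuous_minus (V := R_NormedModule)).
      + apply (continuous_scal_r (V := R_NormedModule) s), continuous_tpow_exp. lra.
      + apply continuous_tpow_exp. lra.
    - apply is_lim_tpow_exp. lra. }
  rewrite tpow_nonpos, Rmult_0_l, Rminus_0_r in h3 by lra.
  assert (h4 := is_RInt_gen_minus _ _ _ _ (is_RInt_gen_scal _ s _ h1) h2).
  assert (h5 : minus (scal s (Gamma s)) (Gamma (s + 1)) = 0).
  { rewrite <- (is_RInt_inf_unique _ _ h3). symmetry. exact (is_RInt_inf_unique _ _ h4). }
  unfold minus, scal, plus, opp in h5; simpl in h5; unfold mult in h5; simpl in h5.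
  lra.
Qed.

Lemma is_lim_pow_exp (k : nat) : is_lim (fun t => t ^ k * exp (- t)) p_infty 0.
Proof.
  (* The exponent is raised by 2 to meet the hypothesis of [tpow_le_exp]; this is harmless for
     [t > 1]. *)
  destruct (tpow_le_exp (INR k + 2)) as (C & hC & hle); [generalize (pos_INR k); lra|].
  apply is_lim_le_le_loc with (fun _ => 0) (fun t => C * exp (- (t / 2))).
  - exists 1. intros t ht. split.
    + apply Rmult_le_pos; [apply pow_le; lra | apply Rlt_le, exp_pos].
    + apply Rle_trans with (2 := hle t). apply Rmult_le_compat_r; [apply Rlt_le, exp_pos|].
      rewrite tpow_pos, <- Rpower_pow by lra. apply Rle_Rpower; lra.
  - apply is_lim_const.
  - evar_last; [apply is_lim_scal_l, is_lim_exp_half | simpl; f_equal; ring].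
Qed.

(** Integer powers are smooth at 0, so integration by parts starts at exponent 0. This reaches
    [Gamma 1] and [Gamma 2], which lie outside the range [3 <= s] and occur as [Gamma (INR v)]. *)
Lemma is_RInt_inf_fact (k : nat) :
  is_RInt_inf (fun t => t ^ k * exp (- t)) (INR (Factorial.fact k)).
Proof.
  assert (hc : forall j t, continuous (fun t => t ^ j * exp (- t)) t).
  { intros j t. apply (ex_derive_continuous (V := R_NormedModule)). auto_derive. trivial. }
  induction k as [|k IH].
  - replace (INR (Factorial.fact 0)) with (0 - - exp (- 0)) by (simpl; rewrite Ropp_0, exp_0; ring).
    apply (is_RInt_inf_primitive (fun t => - exp (- t))).
    + intros t _. auto_derive; [trivial | simpl; ring].
    + intros t _. apply hc.
    + apply is_lim_ext with (fun t => - (t ^ 0 * exp (- t))); [intros t; simpl; ring|].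
      evar_last; [apply is_lim_opp, is_lim_pow_exp | simpl; f_equal; ring].
  - assert (h : is_RInt_inf (fun t => INR (S k) * (t ^ k * exp (- t)) - t ^ S k * exp (- t))
                  (0 - 0 ^ S k * exp (- 0))).
    { apply (is_RInt_inf_primitive (fun t => t ^ S k * exp (- t))).
      - intros t _. auto_derive; [trivial|].
        change (Init.Nat.pred (S k)) with k. change (t ^ S k) with (t * t ^ k).
        change (match k with O => 1 | S _ => INR k + 1 end) with (INR (S k)). ring.
      - intros t _. apply (continuous_minus (V := R_NormedModule)); [|apply hc].
        apply (continuous_scal_r (V := R_NormedModule) (INR (S k))), hc.
      - apply is_lim_pow_exp. }
    assert (h4 := is_RInt_gen_minus _ _ _ _ (is_RInt_gen_scal _ (INR (S k)) _ IH) h).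
    change (Factorial.fact (S k)) with (S k * Factorial.fact k)%nat. rewrite mult_INR.
    replace (INR (S k) * INR (Factorial.fact k)) with
      (minus (scal (INR (S k)) (INR (Factorial.fact k))) (0 - 0 ^ S k * exp (- 0))).
    + revert h4. apply is_RInt_inf_ext. intros t _.
      unfold minus, plus, opp, scal; simpl; unfold mult; simpl. ring.
    + unfold minus, plus, opp, scal; simpl; unfold mult; simpl. ring.
Qed.

Lemma Gamma_fact (k : nat) : Gamma (INR (S k)) = INR (Factorial.fact k).
Proof.
  unfold Gamma. apply is_RInt_inf_unique.
  apply is_RInt_inf_ext with (2 := is_RInt_inf_fact k).
  intros t ht. rewrite S_INR. replace (INR k + 1 - 1) with (INR k) by ring.
  now rewrite Rpower_pow.
Qed.

(** * Moments of the Baskakov kernels *)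

(** The parameter [r] is kept free so that powers of [t] can be absorbed: multiplying by [(c t)^j]
    changes [(r, k)] into [(r - j, k + j)]. *)
Definition beta_kernel (c r : R) (k : nat) (t : R) : R :=
  c * ((c * t) ^ k / Rpower (1 + c * t) (r + INR k)).

(* [beta_value r k] is the Beta integral [B (k + 1, r - 1)]. *)
Fixpoint beta_value (r : R) (k : nat) : R :=
  match k with
  | O => 1 / (r - 1)
  | S k => (INR k + 1) / (r + INR k) * beta_value r k
  end.

(* [Gamma (a + k) / (Gamma (k + 1) * Gamma a)]. *)
Fixpoint gamma_ratio (a : R) (k : nat) : R :=
  match k with
  | O => 1
  | S k => gamma_ratio a k * ((a + INR k) / (INR k + 1))
  end.

Lemma is_derive_Rpower_affine (c s t : R) : 0 < 1 + c * t ->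
  is_derive (fun t => Rpower (1 + c * t) s) t (c * (s * Rpower (1 + c * t) (s - 1))).
Proof.
  intros ht.
  apply (is_derive_comp (V := R_NormedModule) (fun u => Rpower u s) (fun t => 1 + c * t)).
  - apply is_derive_Reals, derivable_pt_lim_power, ht.
  - auto_derive; [trivial | ring].
Qed.

Lemma is_lim_Rpower_affine (c s : R) : 0 < c -> s < 0 ->
  is_lim (fun t => Rpower (1 + c * t) s) p_infty 0.
Proof.
  intros hc hs.
  apply (is_lim_comp exp (fun t => s * ln (1 + c * t)) p_infty 0 m_infty).
  - apply is_lim_exp_m.
  - evar_last.
    + apply is_lim_scal_l.
      apply (is_lim_comp ln (fun t => 1 + c * t) p_infty p_infty p_infty).
      * apply is_lim_ln_p.
      * intros P [M hM]. exists (Rmax 0 (M / c)). intros t ht. apply hM.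
        assert (h1 := Rmax_l 0 (M / c)). assert (h2 := Rmax_r 0 (M / c)).
        assert (h3 : c * (M / c) < c * t) by (apply Rmult_lt_compat_l; lra).
        replace (c * (M / c)) with M in h3 by (field; lra). lra.
      * now exists 0.
    + simpl. destruct (Rle_dec 0 s) as [h | h]; [exfalso; lra | reflexivity].
  - now exists 0.
Qed.

Lemma beta_kernel_ge0 (c r : R) (k : nat) (t : R) : 0 < c -> 0 <= t -> 0 <= beta_kernel c r k t.
Proof.
  intros hc ht. unfold beta_kernel. apply Rmult_le_pos; [lra|].
  apply Rmult_le_pos; [apply pow_le, Rmult_le_pos; lra | apply Rlt_le, Rinv_0_lt_compat, exp_pos].
Qed.

Lemma beta_kernel_alt (c r : R) (k : nat) (t : R) :
  beta_kernel c r k t = c * ((c * t) ^ k * Rpower (1 + c * t) (- (r + INR k))).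
Proof. unfold beta_kernel. now rewrite Rpower_Ropp. Qed.

Lemma continuous_beta_kernel (c r : R) (k : nat) (t : R) : 0 < c -> 0 <= t ->
  continuous (beta_kernel c r k) t.
Proof.
  intros hc ht.
  apply (continuous_ext (fun t => c * ((c * t) ^ k * Rpower (1 + c * t) (- (r + INR k)))));
    [intros u; symmetry; apply beta_kernel_alt|].
  apply (ex_derive_continuous (V := R_NormedModule)).
  apply (ex_derive_scal (fun t => (c * t) ^ k * Rpower (1 + c * t) (- (r + INR k)))).
  apply (ex_derive_mult (fun t => (c * t) ^ k)); [auto_derive; trivial|].
  eexists. apply is_derive_Rpower_affine. nra.
Qed.

(** The derivative of [(c t)^(k+1) * (1 + c t)^(- (r + k))] is [(k + 1)] times kernel [k] minus
    [(r + k)] times kernel [k + 1]. Its integral vanishes because the primitive is at most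
    [(1 + c t)^(1 - r)] at infinity, and this is the recursion of [beta_value]. *)
Lemma is_RInt_inf_beta_kernel (c r : R) (k : nat) : 0 < c -> 1 < r ->
  is_RInt_inf (beta_kernel c r k) (beta_value r k).
Proof.
  intros hc hr. induction k as [|k IH].
  - replace (beta_value r 0) with (0 - - / (r - 1) * Rpower (1 + c * 0) (1 - r)).
    + apply (is_RInt_inf_primitive (fun t => - / (r - 1) * Rpower (1 + c * t) (1 - r))).
      * intros t ht. evar_last; [apply is_derive_scal, is_derive_Rpower_affine; nra|].
        rewrite beta_kernel_alt. replace (1 - r - 1) with (- (r + INR 0)) by (simpl; ring).
        rewrite pow_O. field. lra.
      * intros t ht. now apply continuous_beta_kernel.
      * evar_last; [apply is_lim_scal_l, is_lim_Rpower_affine; lra | simpl; f_equal; ring].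
    + rewrite Rmult_0_r, Rplus_0_r. unfold Rpower. rewrite ln_1, Rmult_0_r, exp_0.
      simpl. field. lra.
  - set (s := r + INR k).
    assert (hk := pos_INR k).
    assert (hs : 1 < s) by (unfold s; lra).
    assert (h : is_RInt_inf (fun t => INR (S k) * beta_kernel c r k t
                                      - s * beta_kernel c r (S k) t)
                  (0 - (c * 0) ^ S k * Rpower (1 + c * 0) (- s))).
    { apply (is_RInt_inf_primitive (fun t => (c * t) ^ S k * Rpower (1 + c * t) (- s))).
      - intros t ht.
        assert (hp : 0 < 1 + c * t) by nra.
        evar_last.
        + apply (is_derive_mult (fun t => (c * t) ^ S k) (fun t => Rpower (1 + c * t) (- s)) t
            (INR (S k) * c * (c * t) ^ k));
            [ | now apply is_derive_Rpower_affine | apply Rmult_comm].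
          auto_derive; [trivial|].
          change (Init.Nat.pred (S k)) with k.
          change (match k with O => 1 | S _ => INR k + 1 end) with (INR (S k)). ring.
        + rewrite !beta_kernel_alt. fold s.
          replace (r + INR (S k)) with (s + 1) by (unfold s; rewrite S_INR; ring).
          replace (- s - 1) with (- (s + 1)) by ring.
          change ((c * t) ^ S k) with (c * t * (c * t) ^ k).
          generalize (INR (S k)) ((c * t) ^ k) (Rpower (1 + c * t) (- (s + 1))) (Rpower (1 + c * t) (- s)).
          intros. unfold plus, mult; simpl. ring.
      - intros t ht. apply (continuous_minus (V := R_NormedModule)).
        + apply (continuous_scal_r (V := R_NormedModule) (INR (S k))).
          now apply continuous_beta_kernel.
        + apply (continuous_scal_r (V := R_NormedModule) s).
          now apply continuous_beta_kernel.
      - apply is_lim_le_le_loc with (fun _ => 0) (fun t => Rpower (1 + c * t) (1 - r)).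
        + exists 0. intros t ht.
          assert (hp : 0 < c * t) by nra.
          split; [apply Rmult_le_pos; [apply pow_le; lra | apply Rlt_le, exp_pos]|].
          apply Rle_trans with ((1 + c * t) ^ S k * Rpower (1 + c * t) (- s)).
          * apply Rmult_le_compat_r; [apply Rlt_le, exp_pos|].
            apply pow_incr; lra.
          * rewrite <- Rpower_pow, <- Rpower_plus by lra.
            right. f_equal. unfold s. rewrite S_INR. ring.
        + apply is_lim_const.
        + apply is_lim_Rpower_affine; lra. }
    assert (h4 := is_RInt_gen_scal _ (/ s) _
      (is_RInt_gen_minus _ _ _ _ (is_RInt_gen_scal _ (INR (S k)) _ IH) h)).
    replace (beta_value r (S k)) with
      (scal (/ s) (minus (scal (INR (S k)) (beta_value r k))
         (0 - (c * 0) ^ S k * Rpower (1 + c * 0) (- s)))).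
    + revert h4. apply is_RInt_inf_ext. intros t _.
      unfold minus, plus, opp, scal; simpl; unfold mult; simpl. field. lra.
    + unfold minus, plus, opp, scal; simpl beta_value; rewrite S_INR; simpl; unfold mult; simpl.
      fold s. field. lra.
Qed.

Lemma gamma_ratio_eq (a : R) (k : nat) : 3 <= a ->
  Gamma (a + INR k) / (Gamma (INR (S k)) * Gamma a) = gamma_ratio a k.
Proof.
  intros ha. assert (hg := Gamma_pos a ha).
  rewrite Gamma_fact.
  induction k as [|k IH]; simpl gamma_ratio.
  - simpl. rewrite Rplus_0_r. field. lra.
  - rewrite <- IH. assert (hk := pos_INR k). assert (hf := INR_fact_lt_0 k).
    change (Factorial.fact (S k)) with (S k * Factorial.fact k)%nat.
    rewrite mult_INR, !S_INR, <- Rplus_assoc, Gamma_succ by lra.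
    field. lra.
Qed.

Lemma p_kernel_eq (n : nat) (c t : R) (k : nat) : 3 <= INR n / c ->
  p_kernel n (S k) c t = gamma_ratio (INR n / c) k * beta_kernel c (INR n / c) k t.
Proof.
  intros ha. unfold p_kernel, beta_kernel.
  replace (S k - 1)%nat with k by lia.
  replace (INR n / c + INR (S k) - 1) with (INR n / c + INR k) by (rewrite S_INR; ring).
  rewrite gamma_ratio_eq by exact ha. ring.
Qed.

Lemma gamma_ratio_pos (a : R) (k : nat) : 0 < a -> 0 < gamma_ratio a k.
Proof.
  intros ha. induction k as [|k IH]; simpl; [lra|]. assert (hk := pos_INR k).
  apply Rmult_lt_0_compat; [exact IH | apply Rdiv_lt_0_compat; lra].
Qed.

(** The recursion factors [(a + k) / (k + 1)] and [(k + 1) / (a + k)] cancel, so the product keeps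
    its value at [k = 0]. *)
Lemma gamma_ratio_beta_value_0 (a : R) (k : nat) : 3 < a ->
  gamma_ratio a k * beta_value a k = 1 / (a - 1).
Proof.
  intros ha. induction k as [|k IH].
  - simpl. ring.
  - assert (hk := pos_INR k). rewrite <- IH. simpl. field. lra.
Qed.

Lemma gamma_ratio_beta_value_1 (a : R) (k : nat) : 3 < a ->
  gamma_ratio a k * beta_value (a - 1) (S k) = (INR k + 1) / ((a - 1) * (a - 2)).
Proof.
  intros ha. induction k as [|k IH].
  - simpl. field. lra.
  - assert (hk := pos_INR k).
    (* Lowering [r] by 1 while raising the index by 1 again cancels [a + k], so the product grows by
       [(k + 2) / (k + 1)]. Multiplying by the inverse reduces the step to [IH]; for the second
       moment the factor is [(k + 3) / (k + 1)]. *)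
    apply Rmult_eq_reg_l with ((INR k + 1) / (INR k + 2)).
    + transitivity (gamma_ratio a k * beta_value (a - 1) (S k)).
      * simpl gamma_ratio. change (beta_value (a - 1) (S (S k))) with
          ((INR (S k) + 1) / (a - 1 + INR (S k)) * beta_value (a - 1) (S k)).
        rewrite S_INR. field. lra.
      * rewrite IH, S_INR. field. lra.
    + apply Rgt_not_eq, Rdiv_lt_0_compat; lra.
Qed.

Lemma gamma_ratio_beta_value_2 (a : R) (k : nat) : 3 < a ->
  gamma_ratio a k * beta_value (a - 2) (S (S k))
  = (INR k + 1) * (INR k + 2) / ((a - 1) * (a - 2) * (a - 3)).
Proof.
  intros ha. induction k as [|k IH].
  - simpl. field. lra.
  - assert (hk := pos_INR k).
    apply Rmult_eq_reg_l with ((INR k + 1) / (INR k + 3)).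
    + transitivity (gamma_ratio a k * beta_value (a - 2) (S (S k))).
      * simpl gamma_ratio. change (beta_value (a - 2) (S (S (S k)))) with
          ((INR (S (S k)) + 1) / (a - 2 + INR (S (S k))) * beta_value (a - 2) (S (S k))).
        rewrite !S_INR. field. lra.
      * rewrite IH, S_INR. field. lra.
    + apply Rgt_not_eq, Rdiv_lt_0_compat; lra.
Qed.

(** The power [t^j] is absorbed into the kernel; [n / c > 3] and [j <= 2] keep the new parameter
    above 1. *)
Lemma is_RInt_inf_p_kernel_pow (n j k : nat) (c : R) :
  0 < c -> 3 < INR n / c -> (j <= 2)%nat ->
  is_RInt_inf (fun t => p_kernel n (S k) c t * t ^ j)
    (gamma_ratio (INR n / c) k * beta_value (INR n / c - INR j) (k + j) / c ^ j).
Proof.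
  intros hc ha hj.
  assert (hj2 : INR j <= 2) by (apply (le_INR j 2), hj).
  assert (hr : 1 < INR n / c - INR j) by lra.
  assert (h := is_RInt_gen_scal _ (gamma_ratio (INR n / c) k / c ^ j) _
    (is_RInt_inf_beta_kernel c (INR n / c - INR j) (k + j) hc hr)).
  assert (hcj : c ^ j <> 0) by (apply pow_nonzero; lra).
  replace (_ / c ^ j) with
    (scal (gamma_ratio (INR n / c) k / c ^ j) (beta_value (INR n / c - INR j) (k + j))).
  - revert h. apply is_RInt_inf_ext. intros t _.
    rewrite p_kernel_eq by lra. unfold scal; simpl; unfold mult; simpl.
    unfold beta_kernel. rewrite pow_add, (Rpow_mult_distr c t j), plus_INR.
    replace (INR n / c - INR j + (INR k + INR j)) with (INR n / c + INR k) by ring.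
    field. split; [apply Rgt_not_eq, exp_pos | exact hcj].
  - unfold scal; simpl; unfold mult; simpl. field. exact hcj.
Qed.

Lemma p_kernel_ge0 (n k : nat) (c t : R) :
  0 < c -> 3 <= INR n / c -> 0 <= t -> 0 <= p_kernel n (S k) c t.
Proof.
  intros hc ha ht. rewrite p_kernel_eq by exact ha.
  apply Rmult_le_pos; [apply Rlt_le, gamma_ratio_pos; lra | now apply beta_kernel_ge0].
Qed.

Lemma continuous_p_kernel (n k : nat) (c t : R) :
  0 < c -> 3 <= INR n / c -> 0 <= t -> continuous (p_kernel n (S k) c) t.
Proof.
  intros hc ha ht.
  apply (continuous_ext (fun t => gamma_ratio (INR n / c) k * beta_kernel c (INR n / c) k t)).
  - intros u. now rewrite p_kernel_eq.
  - apply (continuous_scal_r (V := R_NormedModule) (gamma_ratio (INR n / c) k)).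
    now apply continuous_beta_kernel.
Qed.

(** * The operator *)

(** The class of functions controlled by the moments of order 0 and 2. Continuity at 0 is two-sided
    here, which is why [f] is later extended to the left by [f 0]. *)
Definition quadratic_growth (g : R -> R) : Prop :=
  (forall t, 0 <= t -> continuous g t) /\
  exists A, forall t, 0 <= t -> Rabs (g t) <= A * (1 + t ^ 2).

Lemma quadratic_growth_linear (g h : R -> R) (a b : R) :
  quadratic_growth g -> quadratic_growth h ->
  quadratic_growth (fun t => a * g t + b * h t).
Proof.
  intros [hg [A hA]] [hh [B hB]]. split.
  - intros t ht. apply (continuous_plus (V := R_NormedModule)).
    + apply (continuous_scal_r (V := R_NormedModule) a), hg, ht.
    + apply (continuous_scal_r (V := R_NormedModule) b), hh, ht.
  - exists (Rabs a * A + Rabs b * B). intros t ht.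
    apply Rle_trans with (1 := Rabs_triang _ _). rewrite !Rabs_mult.
    generalize (Rmult_le_compat_l _ _ _ (Rabs_pos a) (hA t ht))
               (Rmult_le_compat_l _ _ _ (Rabs_pos b) (hB t ht)). lra.
Qed.

Lemma quadratic_growth_pow (j : nat) : (j <= 2)%nat -> quadratic_growth (fun t => t ^ j).
Proof.
  intros hj. split.
  - intros t _. apply (ex_derive_continuous (V := R_NormedModule)). auto_derive. trivial.
  - exists 1. intros t ht. rewrite Rabs_pos_eq by (apply pow_le, ht).
    destruct j as [|[|[|j]]]; [ | | |lia]; simpl; nra.
Qed.

Lemma quadratic_growth_bounded (g : R -> R) (B : R) :
  (forall t, continuous g t) -> (forall t, 0 <= t -> Rabs (g t) <= B) -> quadratic_growth g.
Proof.
  intros hg hB. split; [intros t _; apply hg|].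
  exists B. intros t ht. assert (h := hB t ht). assert (h2 := Rabs_pos (g t)). nra.
Qed.

Section Operator.

Variables (n : nat) (c beta : R).
Hypotheses (hc : 0 < c) (hn : 3 < INR n / c) (hbeta : 0 <= beta < 1).

Lemma n_gt : 3 * c < INR n.
Proof.
  apply (Rmult_lt_compat_r c) in hn; [|exact hc].
  unfold Rdiv in hn. rewrite Rmult_assoc, Rinv_l in hn; lra.
Qed.

Lemma ex_RInt_inf_p_kernel (k : nat) (g : R -> R) :
  quadratic_growth g -> ex_RInt_inf (fun t => p_kernel n (S k) c t * g t).
Proof.
  intros [hg [A hA]].
  assert (hp : forall t, 0 <= t -> continuous (p_kernel n (S k) c) t).
  { intros t ht. apply continuous_p_kernel; lra. }
  apply ex_RInt_inf_dominated with (fun t => p_kernel n (S k) c t * (A * (1 + t ^ 2))).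
  - intros t ht. apply (continuous_mult (K := R_AbsRing)); auto.
  - intros t ht. apply (continuous_mult (K := R_AbsRing)); [auto|].
    apply (ex_derive_continuous (V := R_NormedModule)). auto_derive. trivial.
  - intros t ht. rewrite Rabs_mult.
    assert (h := p_kernel_ge0 n k c t hc ltac:(lra) ht).
    rewrite (Rabs_pos_eq (p_kernel n (S k) c t)) by exact h.
    apply Rmult_le_compat_l; auto.
  - eexists. apply is_RInt_inf_ext with
      (fun t => plus (scal A (p_kernel n (S k) c t * t ^ 0)) (scal A (p_kernel n (S k) c t * t ^ 2))).
    + intros t _. unfold plus, scal; simpl; unfold mult; simpl. ring.
    + apply (is_RInt_gen_plus (V := R_NormedModule)); apply (is_RInt_gen_scal (V := R_NormedModule));
        apply is_RInt_inf_p_kernel_pow; auto.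
Qed.

Definition kernel_integral (g : R -> R) (k : nat) : R :=
  RInt_inf (fun t => p_kernel n (S k) c t * g t).

Lemma is_RInt_inf_kernel_integral (g : R -> R) (k : nat) : quadratic_growth g ->
  is_RInt_inf (fun t => p_kernel n (S k) c t * g t) (kernel_integral g k).
Proof.
  intros hg. apply (RInt_gen_correct (V := R_CompleteNormedModule)).
  now apply ex_RInt_inf_p_kernel.
Qed.

Lemma kernel_integral_linear (u g h : R -> R) (a b : R) (k : nat) :
  quadratic_growth g -> quadratic_growth h ->
  (forall t, 0 <= t -> u t = a * g t + b * h t) ->
  kernel_integral u k = a * kernel_integral g k + b * kernel_integral h k.
Proof.
  intros hg hh hu. unfold kernel_integral at 1. apply is_RInt_inf_unique.
  assert (i := is_RInt_gen_plus _ _ _ _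
    (is_RInt_gen_scal _ a _ (is_RInt_inf_kernel_integral g k hg))
    (is_RInt_gen_scal _ b _ (is_RInt_inf_kernel_integral h k hh))).
  revert i. apply is_RInt_inf_ext. intros t ht. rewrite hu by lra.
  unfold plus, scal; simpl; unfold mult; simpl. ring.
Qed.

Lemma kernel_integral_le (g h : R -> R) (k : nat) :
  quadratic_growth g -> quadratic_growth h ->
  (forall t, 0 <= t -> g t <= h t) -> kernel_integral g k <= kernel_integral h k.
Proof.
  intros hg hh hle.
  refine (is_RInt_inf_le _ _ _ _ _ (is_RInt_inf_kernel_integral g k hg)
            (is_RInt_inf_kernel_integral h k hh)).
  intros t ht. apply Rmult_le_compat_l; [apply p_kernel_ge0; lra | auto].
Qed.

Lemma kernel_integral_0 (k : nat) : kernel_integral (fun t => t ^ 0) k = c / (INR n - c).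
Proof.
  assert (h := n_gt).
  unfold kernel_integral. erewrite is_RInt_inf_unique by (apply is_RInt_inf_p_kernel_pow; auto).
  rewrite Nat.add_0_r, Rminus_0_r, gamma_ratio_beta_value_0 by exact hn.
  simpl. field. lra.
Qed.

Lemma kernel_integral_1 (k : nat) :
  kernel_integral (fun t => t ^ 1) k = c / ((INR n - c) * (INR n - 2 * c)) * INR (S k).
Proof.
  assert (h := n_gt).
  unfold kernel_integral. erewrite is_RInt_inf_unique by (apply is_RInt_inf_p_kernel_pow; auto).
  rewrite Nat.add_1_r. change (INR 1) with 1. rewrite gamma_ratio_beta_value_1 by exact hn.
  rewrite S_INR. simpl. field. lra.
Qed.

Lemma kernel_integral_2 (k : nat) :
  kernel_integral (fun t => t ^ 2) k =
  c / ((INR n - c) * (INR n - 2 * c) * (INR n - 3 * c)) * ((INR k + 1) * (INR k + 2)).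
Proof.
  assert (h := n_gt).
  unfold kernel_integral. erewrite is_RInt_inf_unique by (apply is_RInt_inf_p_kernel_pow; auto).
  replace (k + 2)%nat with (S (S k)) by lia. replace (INR 2) with 2 by (simpl; ring).
  rewrite gamma_ratio_beta_value_2 by exact hn.
  simpl. field. lra.
Qed.

Lemma D_op_eq (g : R -> R) (x : R) :
  D_op n c beta g x =
  (INR n - c) / c * Series (fun k => omega_beta beta (S k) (INR n * x) * kernel_integral g k)
  + exp (- (INR n * x)) * g 0.
Proof. reflexivity. Qed.

Section Point.

Variables (x : R).
Hypothesis (hx : 0 <= x).

Lemma nx_ge0 : 0 <= INR n * x.
Proof. apply Rmult_le_pos; [apply pos_INR | exact hx]. Qed.

(** Positivity bounds the kernel integral by [A] times the sum of the zeroth and second moments,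
    quadratic in [k], and the Jain weights decay geometrically. *)
Lemma ex_series_D_op (g : R -> R) : quadratic_growth g ->
  ex_series (fun k => omega_beta beta (S k) (INR n * x) * kernel_integral g k).
Proof.
  intros hg. assert (h := n_gt).
  destruct (proj2 hg) as [A hA].
  assert (hA0 : 0 <= A).
  { assert (h0 := hA 0 (Rle_refl 0)). assert (h1 := Rabs_pos (g 0)). lra. }
  set (C0 := c / (INR n - c)). set (C2 := c / ((INR n - c) * (INR n - 2 * c) * (INR n - 3 * c))).
  assert (hC0 : 0 < C0) by (apply Rdiv_lt_0_compat; lra).
  assert (hC2 : 0 < C2).
  { apply Rdiv_lt_0_compat; [lra|]. repeat apply Rmult_lt_0_compat; lra. }
  assert (h0 := quadratic_growth_pow 0 ltac:(lia)). assert (h2 := quadratic_growth_pow 2 ltac:(lia)).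
  assert (hr := rho_bounds beta hbeta).
  apply (ex_series_le (K := R_AbsRing) (V := R_CompleteNormedModule) _
    (fun k => exp (lam beta * (INR n * x)) * (A * (C0 + C2)) *
              ((INR k + 1) * (INR k + 2) * rho beta ^ k))).
  2: { apply (ex_series_scal (K := R_AbsRing) (V := R_NormedModule)).
       now apply ex_series_quadratic_geometric. }
  intros k. change (norm ?z) with (Rabs z). rewrite Rabs_mult.
  destruct (omega_beta_S_bounds beta (INR n * x) k hbeta nx_ge0) as [hw1 hw2].
  assert (hk := pos_INR k).
  assert (hI : Rabs (kernel_integral g k) <= A * (C0 + C2) * ((INR k + 1) * (INR k + 2))).
  { apply Rle_trans with (A * C0 + A * (C2 * ((INR k + 1) * (INR k + 2)))).
    - unfold C0, C2. rewrite <- kernel_integral_0 with (k := k), <- kernel_integral_2.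
      apply Rabs_le. split.
      + rewrite Ropp_plus_distr, !Ropp_mult_distr_l.
        rewrite <- (kernel_integral_linear (fun t => - A * t ^ 0 + - A * t ^ 2)); trivial.
        apply kernel_integral_le; trivial.
        * now apply quadratic_growth_linear.
        * intros t ht. generalize (hA t ht). unfold Rabs; destruct Rcase_abs; lra.
      + rewrite <- (kernel_integral_linear (fun t => A * t ^ 0 + A * t ^ 2)); trivial.
        apply kernel_integral_le; trivial.
        * now apply quadratic_growth_linear.
        * intros t ht. generalize (hA t ht). unfold Rabs; destruct Rcase_abs; lra.
    - assert (1 <= (INR k + 1) * (INR k + 2)) by nra.
      assert (0 <= A * C0) by (apply Rmult_le_pos; lra).
      assert (0 <= A * C0 * ((INR k + 1) * (INR k + 2) - 1)) by (apply Rmult_le_pos; lra).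
      lra. }
  rewrite (Rabs_pos_eq (omega_beta _ _ _)) by exact hw1.
  apply Rle_trans with (rho beta ^ k * exp (lam beta * (INR n * x)) *
    (A * (C0 + C2) * ((INR k + 1) * (INR k + 2)))); [|lra].
  apply Rmult_le_compat; trivial. apply Rabs_pos.
Qed.

(** The identity for [u] is asked only on [t >= 0], so with coefficients 1 and 0 this also shows
    that [D_op] depends only on values on the half-line. *)
Lemma D_op_linear (u g h : R -> R) (a b : R) :
  quadratic_growth g -> quadratic_growth h ->
  (forall t, 0 <= t -> u t = a * g t + b * h t) ->
  D_op n c beta u x = a * D_op n c beta g x + b * D_op n c beta h x.
Proof.
  intros hg hh hu. rewrite !D_op_eq, hu by lra.
  rewrite (Series_ext _ (fun k =>
    a * (omega_beta beta (S k) (INR n * x) * kernel_integral g k) +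
    b * (omega_beta beta (S k) (INR n * x) * kernel_integral h k))).
  - rewrite Series_plus.
    + rewrite !Series_scal_l. ring.
    + apply (ex_series_scal (K := R_AbsRing) (V := R_NormedModule)). now apply ex_series_D_op.
    + apply (ex_series_scal (K := R_AbsRing) (V := R_NormedModule)). now apply ex_series_D_op.
  - intros k. rewrite (kernel_integral_linear u g h a b k hg hh hu). ring.
Qed.

Lemma D_op_ge0 (g : R -> R) : quadratic_growth g -> (forall t, 0 <= t -> 0 <= g t) ->
  0 <= D_op n c beta g x.
Proof.
  intros hg hp. assert (h := n_gt). rewrite D_op_eq.
  apply Rplus_le_le_0_compat.
  - apply Rmult_le_pos; [apply Rlt_le, Rdiv_lt_0_compat; lra|].
    (* The product form lets [Series_scal_l] evaluate the zero series. *)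
    replace 0 with (Series (fun _ => 0 * 0)) by (rewrite Series_scal_l; ring).
    apply Series_le; [|now apply ex_series_D_op].
    intros k. split; [lra|]. rewrite Rmult_0_l.
    apply Rmult_le_pos; [apply (omega_beta_S_bounds beta (INR n * x) k hbeta nx_ge0)|].
    assert (h0 := quadratic_growth_pow 0 ltac:(lia)).
    replace 0 with (kernel_integral (fun t => 0 * t ^ 0 + 0 * t ^ 0) k).
    + apply kernel_integral_le; trivial; [now apply quadratic_growth_linear|].
      intros t ht. generalize (hp t ht). lra.
    + rewrite (kernel_integral_linear _ (fun t => t ^ 0) (fun t => t ^ 0) 0 0); trivial. ring.
  - apply Rmult_le_pos; [apply Rlt_le, exp_pos | apply hp; lra].
Qed.

Lemma D_op_le (g h : R -> R) : quadratic_growth g -> quadratic_growth h ->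
  (forall t, 0 <= t -> g t <= h t) -> D_op n c beta g x <= D_op n c beta h x.
Proof.
  intros hg hh hle.
  assert (h1 : 0 <= D_op n c beta (fun t => 1 * h t + -1 * g t) x).
  { apply D_op_ge0; [now apply quadratic_growth_linear|].
    intros t ht. generalize (hle t ht). lra. }
  rewrite (D_op_linear _ h g 1 (-1)) in h1; trivial. lra.
Qed.

Lemma D_op_1 : D_op n c beta (fun t => t ^ 0) x = 1.
Proof.
  assert (h := n_gt). rewrite D_op_eq.
  rewrite (Series_ext _ (fun k => c / (INR n - c) * omega_beta beta (S k) (INR n * x))).
  - rewrite Series_scal_l, (is_series_unique _ _ (is_series_omega_beta beta (INR n * x) hbeta nx_ge0)).
    simpl. field. lra.
  - intros k. rewrite kernel_integral_0. ring.
Qed.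

(** The first Jain moment is at least [n x], and the Baskakov part multiplies it by [1 / (n - 2c)];
    since [c > 0], [n x / (n - 2c) > x]. *)
Lemma D_op_id_gt : 0 < x -> x < D_op n c beta (fun t => t ^ 1) x.
Proof.
  intros hx0. assert (h := n_gt). rewrite D_op_eq.
  assert (hnx : 0 < INR n * x) by (apply Rmult_lt_0_compat; lra).
  set (C := c / ((INR n - c) * (INR n - 2 * c))).
  assert (hC : 0 < C).
  { apply Rdiv_lt_0_compat; [lra|]. apply Rmult_lt_0_compat; lra. }
  assert (hext : forall k, omega_beta beta (S k) (INR n * x) * kernel_integral (fun t => t ^ 1) k
                     = C * (INR (S k) * omega_beta beta (S k) (INR n * x))).
  { intros k. rewrite kernel_integral_1. fold C. ring. }
  assert (hex : ex_series (fun k => INR (S k) * omega_beta beta (S k) (INR n * x))).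
  { assert (h1 := ex_series_scal (K := R_AbsRing) (V := R_NormedModule) (/ C) _
      (ex_series_D_op _ (quadratic_growth_pow 1 ltac:(lia)))).
    revert h1. apply ex_series_ext. intros k. rewrite hext.
    unfold scal; simpl; unfold mult; simpl. field. lra. }
  rewrite (Series_ext _ _ hext), Series_scal_l.
  assert (hge := omega_beta_moment_ge beta (INR n * x) hbeta hnx hex).
  set (S0 := Series _) in *. rewrite pow_1, Rmult_0_r, Rplus_0_r.
  replace ((INR n - c) / c * (C * S0)) with (S0 / (INR n - 2 * c)) by (unfold C; field; lra).
  apply Rlt_le_trans with (INR n * x / (INR n - 2 * c)).
  - apply Rmult_lt_reg_r with (INR n - 2 * c); [lra|].
    unfold Rdiv. rewrite Rmult_assoc, Rinv_l by lra. nra.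
  - apply Rmult_le_compat_r; [apply Rlt_le, Rinv_0_lt_compat; lra | exact hge].
Qed.

Lemma mu1_eq : mu1 n c beta x = D_op n c beta (fun t => t ^ 1) x - x.
Proof.
  unfold mu1. rewrite (D_op_linear _ (fun t => t ^ 1) (fun t => t ^ 0) 1 (- x)).
  - rewrite D_op_1. ring.
  - apply quadratic_growth_pow; lia.
  - apply quadratic_growth_pow; lia.
  - intros t _. simpl. ring.
Qed.

Lemma mu1_pos : 0 < x -> 0 < mu1 n c beta x.
Proof. intros hx0. rewrite mu1_eq. generalize (D_op_id_gt hx0). lra. Qed.

Lemma D_op_affine (a b : R) :
  D_op n c beta (fun t => a * t ^ 1 + b * t ^ 0) x = a * (x + mu1 n c beta x) + b.
Proof.
  rewrite (D_op_linear _ (fun t => t ^ 1) (fun t => t ^ 0) a b), D_op_1, mu1_eq;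
    [ring | apply quadratic_growth_pow; lia | apply quadratic_growth_pow; lia | reflexivity].
Qed.

Lemma quadratic_growth_affine (a b : R) : quadratic_growth (fun t => a * t ^ 1 + b * t ^ 0).
Proof. apply quadratic_growth_linear; apply quadratic_growth_pow; lia. Qed.

Lemma quadratic_growth_sqr (y : R) : quadratic_growth (fun t => (t - y) ^ 2).
Proof.
  assert (h := quadratic_growth_linear _ _ 1 1 (quadratic_growth_pow 2 ltac:(lia))
                 (quadratic_growth_affine (-2 * y) (y ^ 2))).
  split.
  - intros t _. apply (ex_derive_continuous (V := R_NormedModule)). auto_derive. trivial.
  - destruct h as [_ [A hA]]. exists A. intros t ht.
    replace ((t - y) ^ 2) with (1 * t ^ 2 + 1 * (-2 * y * t ^ 1 + y ^ 2 * t ^ 0)) by (simpl; ring).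
    auto.
Qed.

Lemma D_op_variance :
  D_op n c beta (fun t => (t - (x + mu1 n c beta x)) ^ 2) x = mu2 n c beta x - mu1 n c beta x ^ 2.
Proof.
  set (m := mu1 n c beta x).
  rewrite (D_op_linear _ (fun t => (t - x) ^ 2)
    (fun t => (-2 * m) * t ^ 1 + (2 * m * x + m ^ 2) * t ^ 0) 1 1).
  - rewrite D_op_affine. fold m. unfold mu2. ring.
  - apply quadratic_growth_sqr.
  - apply quadratic_growth_affine.
  - intros t _. simpl. ring.
Qed.

Lemma D_op_estimate (f : R -> R) (B : R) : 0 < x ->
  (forall t, continuous f t) -> (forall t, 0 <= t -> Rabs (f t) <= B) ->
  Rabs (D_op n c beta f x - f (x + mu1 n c beta x))
    <= 36 * modulus2 f (sqrt (mu1 n c beta x ^ 2 + mu2 n c beta x)).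
Proof.
  intros hx0 hf hB.
  assert (hm := mu1_pos hx0).
  assert (hv := D_op_variance).
  set (m := mu1 n c beta x) in *. set (e := x + m) in *.
  assert (hmu2 : 0 <= mu2 n c beta x).
  { apply D_op_ge0; [apply quadratic_growth_sqr | intros; apply pow2_ge_0]. }
  set (d := sqrt _).
  assert (hm2 : 0 < m ^ 2) by (apply pow_lt, hm).
  assert (hd : 0 < d) by (apply sqrt_lt_R0; lra).
  assert (hd2 : d ^ 2 = m ^ 2 + mu2 n c beta x) by (apply pow2_sqrt; lra).
  set (W := modulus2 f d).
  assert (hW := second_diff_le_modulus2 f B d hB). fold W in hW.
  destruct (affine_approximation f e d W B) as [l hl]; trivial; [unfold e; lra|].
  assert (hW0 : 0 <= W).
  { eapply Rle_trans; [apply Rabs_pos | apply (hW 0 d); lra]. }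
  assert (hfa := quadratic_growth_bounded f B hf hB).
  assert (h0 := quadratic_growth_pow 0 ltac:(lia)).
  assert (h1 := quadratic_growth_affine (- l) (l * e - f e)).
  assert (h2 := quadratic_growth_sqr e).
  (* This is [f] minus the approximating line, so its image is [D_op f x - f e]. *)
  set (u := fun t => 1 * f t + 1 * (- l * t ^ 1 + (l * e - f e) * t ^ 0)).
  assert (hu : quadratic_growth u) by now apply quadratic_growth_linear.
  assert (hDu : D_op n c beta u x = D_op n c beta f x - f e).
  { rewrite (D_op_linear u f _ 1 1 hfa h1) by reflexivity.
    rewrite D_op_affine. fold m. fold e. ring. }
  assert (hDv : forall s, D_op n c beta (fun t => s * t ^ 0 + s / d ^ 2 * (t - e) ^ 2) x
                          = s * (1 + (mu2 n c beta x - m ^ 2) / d ^ 2)).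
  { intros s. rewrite (D_op_linear _ _ _ s (s / d ^ 2) h0 h2) by reflexivity.
    rewrite D_op_1, hv. field. lra. }
  (* The normalized variance is at most 1, which doubles the constant 18. *)
  assert (hle : (mu2 n c beta x - m ^ 2) / d ^ 2 <= 1).
  { apply Rmult_le_reg_r with (d ^ 2); [apply pow_lt, hd|].
    unfold Rdiv. rewrite Rmult_assoc, Rinv_l by (apply pow_nonzero; lra). lra. }
  assert (hbound : forall t, 0 <= t -> Rabs (u t) <= 18 * W + 18 * W / d ^ 2 * (t - e) ^ 2).
  { intros t ht. assert (h := hl t ht).
    replace (u t) with (f t - f e - l * (t - e)) by (unfold u; simpl; ring).
    replace (18 * W + _) with (18 * W * (1 + ((t - e) / d) ^ 2)) by (field; lra).
    exact h. }
  assert (hup : D_op n c beta u x <= 36 * W).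
  { apply Rle_trans with (D_op n c beta (fun t => 18 * W * t ^ 0 + 18 * W / d ^ 2 * (t - e) ^ 2) x).
    - apply D_op_le; trivial; [now apply quadratic_growth_linear|].
      intros t ht. apply Rle_trans with (1 := Rle_abs _).
      rewrite pow_O, Rmult_1_r. now apply hbound.
    - rewrite hDv. nra. }
  assert (hlo : - (36 * W) <= D_op n c beta u x).
  { apply Rle_trans with
      (D_op n c beta (fun t => - (18 * W) * t ^ 0 + - (18 * W) / d ^ 2 * (t - e) ^ 2) x).
    - rewrite hDv. nra.
    - apply D_op_le; trivial; [now apply quadratic_growth_linear|].
      intros t ht. rewrite pow_O, Rmult_1_r.
      assert (h := hbound t ht). revert h.
      replace (- (18 * W) / d ^ 2 * (t - e) ^ 2) with (- (18 * W / d ^ 2 * (t - e) ^ 2)) by (field; lra).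
      unfold Rabs; destruct Rcase_abs; lra. }
  rewrite <- hDu. apply Rabs_le. lra.
Qed.

End Point.

Lemma D_op_at_0 (g : R -> R) : D_op n c beta g 0 = g 0.
Proof.
  rewrite D_op_eq.
  rewrite (Series_ext _ (fun _ => 0 * 0)).
  - rewrite Series_scal_l, Rmult_0_r, Ropp_0, exp_0. ring.
  - intros k. unfold omega_beta. unfold Rdiv. rewrite !Rmult_0_r, !Rmult_0_l. ring.
Qed.

End Operator.

(** * From the half-line to the real line, and the final estimate *)

Lemma modulus2_ext (f g : R -> R) (d : R) :
  (forall t, 0 <= t -> f t = g t) -> modulus2 f d = modulus2 g d.
Proof.
  intros h. unfold modulus2. f_equal. apply Lub_Rbar_eqset. intros r.
  split; intros (k & y & hk & hkd & hy & ->); exists k, y; repeat split; trivial;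
    rewrite !h by lra; reflexivity.
Qed.

(** Since [t |-> Rmax 0 t] is 1-Lipschitz, one-sided continuity at 0 becomes continuity on the whole
    line. *)
Lemma continuous_Rmax_0 (f : R -> R) : CB0inf f -> forall t, continuous (fun t => f (Rmax 0 t)) t.
Proof.
  intros [hf _] t.
  apply (filterlim_locally (fun t => f (Rmax 0 t))). intros eps.
  destruct (hf (Rmax 0 t) (Rmax_l 0 t) eps (cond_pos eps)) as (d & hd & h).
  exists (mkposreal d hd). intros y hy.
  apply (h (Rmax 0 y) (Rmax_l 0 y)).
  apply Rle_lt_trans with (Rabs (y - t)); [|exact hy].
  unfold Rmax; repeat destruct Rle_dec; unfold Rabs; repeat destruct Rcase_abs; lra.
Qed.

Theorem theorem1 :
  exists M : R, 0 < M /\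
  forall (c beta : R) (n : nat) (f : R -> R) (x : R),
    0 < c -> 0 <= beta < 1 -> INR n > 3 * c ->
    CB0inf f -> 0 <= x ->
    Rabs (D_op n c beta f x - f x)
      <= modulus1 f (mu1 n c beta x)
         + M * modulus2 f (sqrt ((mu1 n c beta x) ^ 2 + mu2 n c beta x)).
Proof.
  exists 36. split; [lra|].
  intros c beta n f x hc hbeta hn hf hx.
  destruct (proj2 hf) as [B hB].
  destruct (Req_dec x 0) as [-> | hne].
  (* At 0 all Jain weights of positive index vanish, so both sides reduce to moduli at [d = 0], and
     [modulus1 f 0 >= 0] remains. *)
  - unfold mu1, mu2. rewrite !D_op_at_0, !Rminus_diag, Rabs_R0.
    replace (0 ^ 2 + 0 ^ 2) with 0 by ring. rewrite sqrt_0, modulus2_0.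
    assert (h := le_modulus1 f B 0 0 0 hB hx hx).
    rewrite !Rminus_diag, Rabs_R0 in h. lra.
  - assert (hx0 : 0 < x) by lra.
    assert (hnc : 3 < INR n / c).
    { apply Rmult_lt_reg_r with c; [exact hc|].
      unfold Rdiv. rewrite Rmult_assoc, Rinv_l; lra. }
    set (g := fun t => f (Rmax 0 t)).
    assert (hfg : forall t, 0 <= t -> f t = g t).
    { intros t ht. unfold g. now rewrite Rmax_right. }
    assert (hgc := continuous_Rmax_0 f hf). fold g in hgc.
    assert (hgB : forall t, 0 <= t -> Rabs (g t) <= B) by (intros t ht; rewrite <- hfg; auto).
    assert (hm := mu1_pos n c beta hc hnc hbeta x hx hx0).
    assert (hest := D_op_estimate n c beta hc hnc hbeta x hx g B hx0 hgc hgB).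
    rewrite <- hfg, <- (modulus2_ext f g) in hest by (trivial; lra).
    assert (hD : D_op n c beta f x = D_op n c beta g x).
    { assert (hq := quadratic_growth_bounded g B hgc hgB).
      rewrite (D_op_linear n c beta hc hnc hbeta x hx f g g 1 0 hq hq); [ring|].
      intros t ht. rewrite hfg by exact ht. ring. }
    rewrite <- hD in hest.
    assert (hmod := le_modulus1 f B (mu1 n c beta x) x (x + mu1 n c beta x) hB hx ltac:(lra)).
    replace (x + mu1 n c beta x - x) with (mu1 n c beta x) in hmod by ring.
    rewrite Rabs_pos_eq in hmod by lra. specialize (hmod (Rle_refl _)).
    (* Split at [f e] with [e = x + mu1], one term for each modulus. *)
    replace (D_op n c beta f x - f x) with
      ((f (x + mu1 n c beta x) - f x) + (D_op n c beta f x - f (x + mu1 n c beta x))) by ring.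
    apply Rle_trans with (1 := Rabs_triang _ _). lra.
Qed.
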